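(* Let $\mathcal{I}=(p_1,\ldots,p_k)$ be a $k$-tuple of invariant factors with $\deg\prod_{i=1}^k p_i=d$, where $d\le k\le n$. Then the number $N_q(n,k;\mathcal{I})=\#\{B\in M_{n,k}(\mathbb{F}_q): xI_{n,k}-B \text{ has invariant factors } p_1,\ldots,p_k\}$ (equivalently, the number of $T\in L(W,V)$ with $\mathcal{I}_T=\mathcal{I}$) equals $$N_q(n,k;\mathcal{I})={k\brack d}_q\frac{|\mathrm{GL}_d(\mathbb{F}_q)|}{\prod_{f\in S(\mathcal{I})}c_f(\Phi_{\mathcal{I}}(f))}\prod_{i=d+1}^{k}(q^n-q^i).$$
   Context: Let $\mathbb{F}_q$ be the finite field with $q$ elements, $n\ge k$ positive integers, $V$ an $n$-dimensional $\mathbb{F}_q$-vector space and $W\subseteq V$ a $k$-dimensional subspace, with an ordered basis $\mathcal{B}_1$ of $W$ extended to an ordered basis $\mathcal{B}_2$ of $V$; $L(W,V)$ is the space of linear maps $W\to V$. $I_{n,k}\in M_{n,k}(\mathbb{F}_q)$ has $(i,j)$ entry $1$ if $i=j$ and $0$ otherwise. For nonzero $A\in M_{n,k}(\mathbb{F}_q[x])$, $\delta_i(A)$ is the monic gcd of its $i\times i$ minors ($\delta_0=1$), and its invariant factors are $p_i=\delta_i(A)/\delta_{i-1}(A)$ (the diagonal of its Smith normal form). For $B\in M_{n,k}(\mathbb{F}_q)$, $xI_{n,k}-B$ has exactly $k$ invariant factors $p_1\mid\cdots\mid p_k$; the invariant factors $\mathcal{I}_T$ of $T\in L(W,V)$ are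 those of $xI_{n,k}-B$ for $B$ the matrix of $T$ w.r.t. $\mathcal{B}_1,\mathcal{B}_2$. A $k$-tuple of invariant factors is a tuple of monic polynomials $(p_1,\ldots,p_k)$ with $p_i\mid p_{i+1}$. ${k\brack d}_q=\prod_{i=0}^{d-1}\frac{q^{k-i}-1}{q^{i+1}-1}$ is the $q$-binomial coefficient. Partition notation: for a partition $\lambda$ with conjugate $\lambda'$, $m_i=\lambda_i'-\lambda_{i+1}'$, $h_i=\lambda_1'+\cdots+\lambda_i'$; for irreducible $f$ of degree $e$, $c_f(\lambda)=\prod_{i\ge1}\prod_{j=1}^{m_i}(q^{eh_i}-q^{e(h_i-j)})$. For irreducible $f$ and nonzero $g$, $\nu_f(g)=\max\{e:f^e\mid g\}$. For $\mathcal{I}=(p_1,\ldots,p_k)$ and $P=\prod p_i$, $S(\mathcal{I})$ is the set of monic irreducible divisors of $P$ and $\Phi_{\mathcal{I}}(f)=(\nu_f(p_k),\nu_f(p_{k-1}),\ldots,\nu_f(p_r))$ with $r=\min\{i:\nu_f(p_i)>0\}$. Conventions: $|\mathrm{GL}_0(\mathbb{F}_q)|=1$, empty products equal $1$. *)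

(* Defs.v *)
From HB Require Import structures.
From mathcomp Require Import all_boot all_order all_algebra all_fingroup all_field.
Set Implicit Arguments. Unset Strict Implicit. Unset Printing Implicit Defensive.
Import Order.TTheory GRing.Theory Num.Theory.
Local Open Scope ring_scope.

Section Defs.
Variable F : finFieldType.

Definition incr_sel (i m : nat) (f : {ffun 'I_i -> 'I_m}) : bool :=
  [forall a : 'I_i, forall b : 'I_i, (a < b)%N ==> (f a < f b)%N].

Definition minors (n k : nat) (A : 'M[{poly F}]_(n, k)) (i : nat) : seq {poly F} :=
  [seq \det (\matrix_(a < i, b < i) A (f a) (g b))
   | f : {ffun 'I_i -> 'I_n} <- [seq f <- enum {ffun 'I_i -> 'I_n} | incr_sel f],
     g : {ffun 'I_i -> 'I_k} <- [seq g <- enum {ffun 'I_i -> 'I_k} | incr_sel g]].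

(* monic normalisation of a polynomial (0 stays 0) *)
Definition monicize (p : {poly F}) : {poly F} := (lead_coef p)^-1 *: p.

Definition delta (n k : nat) (A : 'M[{poly F}]_(n, k)) (i : nat) : {poly F} :=
  monicize (foldr (@gcdp F) 0 (minors A i)).

(* i-th invariant factor p_i = delta_i / delta_{i-1} (1-indexed) *)
Definition invf (n k : nat) (A : 'M[{poly F}]_(n, k)) (i : nat) : {poly F} :=
  delta A i %/ delta A i.-1.

Definition xImB (n k : nat) (B : 'M[F]_(n, k)) : 'M[{poly F}]_(n, k) :=
  \matrix_(i < n, j < k) ((if (i : nat) == (j : nat) then 'X else 0) - (B i j)%:P).

Definition has_invf (n k : nat) (B : 'M[F]_(n, k)) (p : seq {poly F}) : bool :=
  [forall i : 'I_k, invf (xImB B) i.+1 == p`_i].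

Definition is_invf_tuple (k : nat) (p : seq {poly F}) : Prop :=
  [/\ size p = k, (forall i, (i < k)%N -> p`_i \is monic)
    & (forall i, (i.+1 < k)%N -> p`_i %| p`_i.+1)].

(* nu_f(g) = max{e : f^e | g} (for g <> 0, f non-constant, e < size g) *)
Definition nu (f g : {poly F}) : nat := \big[maxn/0%N]_(e < size g | dvdp (f ^+ e) g) (e : nat).

Definition Phi (p : seq {poly F}) (f : {poly F}) : seq nat :=
  let r := find (fun pi => (0 < nu f pi)%N) p in rev (drop r (map (nu f) p)).

Definition glcard (d : nat) : nat := #|[set A : 'M[F]_d | A \in unitmx]|.

End Defs.

Definition conjp (lam : seq nat) (i : nat) : nat := count (fun l => (i <= l)%N) lam.

(* c_f(lambda) for deg f = e, over F_q *)
Definition cf (q e : nat) (lam : seq nat) : rat :=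
  let m i := (conjp lam i - conjp lam i.+1)%N in
  let h i := (\sum_(1 <= t < i.+1) conjp lam t)%N in
  \prod_(1 <= i < (\max_(l <- lam) l).+1)
    \prod_(1 <= j < (m i).+1) ((q ^ (e * h i))%:R - (q ^ (e * (h i - j)))%:R).

Definition qbinom (q k d : nat) : rat :=
  \prod_(i < d) (((q ^ (k - i))%:R - 1) / ((q ^ i.+1)%:R - 1)).

(* Main.v *)
Require Import Defs.
From HB Require Import structures.
From mathcomp Require Import all_boot all_order all_algebra all_fingroup all_field.
From mathcomp Require Import zify ring.
Import Order.TTheory GRing.Theory Num.Theory.
Set Implicit Arguments. Unset Strict Implicit. Unset Printing Implicit Defensive.
Local Open Scope ring_scope.

(* A matrix B in M_(n,k) is a linear map from W = F^k to V = F^n. It has a largest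
   invariant subspace U of W; if dim U = d, the pencil of B is equivalent, after padding
   with k - d ones, to the characteristic matrix of C = B|U, so both have the same
   nontrivial invariant factors.  Counting pairs (B, basis adapted to U) in two ways
   reduces the theorem to two counts:
   - the matrices without nonzero invariant subspace, obtained by induction from the fact
     that the counts for all d add up to q^(nk), an instance of q-Chu-Vandermonde;
   - the C in M_d with given invariant factors p_1 | ... | p_d. If p = p_d has degree
     e > 0, a vector v whose annihilator is exactly p spans a cyclic invariant subspace
     that splits off, and the complement has the invariant factors p_1, ..., p_(d-1) (with
     e - 1 ones removed). Counting pairs (C, splitting) in two ways gives a recursion,
     which the product of the c_f satisfies as well when the largest part of each
     partition is removed. The number of such v is q^d prod_f (1 - q^(-deg f * m_f)), with
     m_f the multiplicity of the largest part, by inclusion-exclusion over the prime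
     divisors f of p. *)

(** * Determinantal divisors and equivalence of polynomial matrices *)

(** Invariant factors are defined by minors and computed by exhibiting a diagonal form: matrices of
    any shapes that are two-sided multiples of each other have the same divisors of [delta], and for
    a divisibility chain on the diagonal [delta] can be read off. A cyclic summand has many
    complements. They are parametrised by functionals u dual to v, an affine space, which turns the
    splittings into something countable. The rectangular case works with linear forms: for B =
    [col_mx Bt Bb] the annihilator of U is the smallest space of forms containing the rows of [Bb]
    and stable under [Bt], of dimension r = k - d. In adapted coordinates the rest of B is a pair
    (D, E) without nonzero invariant subspace; its pencil has a left inverse over F[x], which is why
    it contributes only ones. *)

Section Minors.
Variable F : finFieldType.
Implicit Types (g : {poly F}) (n k i : nat).

(** All selections are allowed, not only increasing ones, so that stability under products is
    immediate. The conditions agree: a repeated index gives the minor 0, a reordering only a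
    sign. *)
Definition dvd_minors g i n k (A : 'M[{poly F}]_(n, k)) : Prop :=
  forall (f : 'I_i -> 'I_n) (h : 'I_i -> 'I_k), g %| \det (mxsub f h A).

Lemma dvdp_foldr_gcd g (s : seq {poly F}) :
  (g %| foldr (@gcdp F) 0 s) = all (dvdp g) s.
Proof. by elim: s => [|a s IH] /=; rewrite ?dvdp0 // dvdp_gcd IH. Qed.

Lemma dvdp_monicize g (p : {poly F}) : (g %| monicize p) = (g %| p).
Proof.
rewrite /monicize; have [->|p0] := eqVneq p 0; first by rewrite scaler0.
by rewrite dvdpZr // invr_eq0 lead_coef_eq0.
Qed.

Lemma dvdp_delta g i n k (A : 'M[{poly F}]_(n, k)) :
  reflect (forall (f : {ffun 'I_i -> 'I_n}) (h : {ffun 'I_i -> 'I_k}),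
              incr_sel f -> incr_sel h -> g %| \det (mxsub f h A))
          (g %| delta A i).
Proof.
rewrite /delta dvdp_monicize dvdp_foldr_gcd; apply: (iffP allP) => [H f h Hf Hh|H m].
  apply: H; apply/allpairsP; exists (f, h) => /=.
  split; [rewrite mem_filter Hf mem_enum //|rewrite mem_filter Hh mem_enum //|].
  by congr (\det _); apply/matrixP=> a b; rewrite !mxE.
case/allpairsP=> -[f h] /= []; rewrite !mem_filter => /andP[Hf _] /andP[Hh _] ->.
have -> : \matrix_(a, b) A (f a) (h b) = mxsub f h A by apply/matrixP=> a b; rewrite !mxE.
exact: H.
Qed.

Lemma sort_injective i n (f : 'I_i -> 'I_n) : injective f ->
  exists p : 'S_i, incr_sel [ffun a => f (p a)].
Proof.
move=> finj; pose t := [tuple f a | a < i].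
pose r := fun x y : 'I_n => (x <= y)%N.
have tot : total r by move=> x y; apply: leq_total.
have /tuple_permP[p Hp] : perm_eq (sort r t) t by rewrite perm_sort.
exists p; apply/forallP=> a; apply/forallP=> b; apply/implyP=> ab.
have ut : uniq (sort r t) by rewrite sort_uniq map_inj_uniq // enum_uniq.
have st : sorted ltn (map val (sort r t)).
  rewrite ltn_sorted_uniq_leq map_inj_uniq ?ut; last exact: val_inj.
  by rewrite sorted_map; apply: sort_sorted.
have sz : size (sort r t) = i by rewrite size_sort size_tuple.
have E c : f (p c) = nth (f a) (sort r t) c.
  by rewrite Hp -tnth_nth tnth_map tnth_ord_tuple tnth_map tnth_ord_tuple.
have K c : val (f (p c)) = nth 0%N (map val (sort r t)) c.
  by rewrite E (nth_map (f a)) ?sz.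
rewrite !ffunE -[X in (X < _)%N]/(val (f (p a))) -[X in (_ < X)%N]/(val (f (p b))) !K.
by apply: (sorted_ltn_nth ltn_trans) => //; rewrite inE size_map sz.
Qed.

Lemma dvdp_minor_rowP g i n (Y : 'M[{poly F}]_(n, i)) :
  (forall f : {ffun 'I_i -> 'I_n}, incr_sel f -> g %| \det (rowsub f Y)) ->
  forall f : 'I_i -> 'I_n, g %| \det (rowsub f Y).
Proof.
move=> H f; have [/injectiveP finj|/injectivePn[a [b ab fab]]] := boolP (injectiveb f).
  have [p /H Hp] := sort_injective finj.
  have E : rowsub [ffun a => f (p a)] Y = perm_mx p *m rowsub f Y.
    by rewrite -row_permE; apply/matrixP=> a b; rewrite !mxE ffunE.
  rewrite E det_mulmx det_perm in Hp.
  by case: (odd_perm p) Hp; rewrite ?mul1r // expr1 mulN1r dvdpNr.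
rewrite (determinant_alternate ab) ?dvdp0 // => c.
by rewrite !mxE fab.
Qed.

Lemma dvd_minorsP g i n k (A : 'M[{poly F}]_(n, k)) :
  reflect (dvd_minors g i A) (g %| delta A i).
Proof.
apply: (iffP (dvdp_delta _ _ _)) => H; last by move=> f h _ _; apply: H.
move=> f h.
have -> : mxsub f h A = rowsub f (colsub h A) by apply/matrixP=> a b; rewrite !mxE.
move: f; apply: dvdp_minor_rowP => f Hf.
rewrite -det_tr.
have -> : (rowsub f (colsub h A))^T = rowsub h (rowsub f A)^T.
  by apply/matrixP=> a b; rewrite !mxE.
move: h; apply: dvdp_minor_rowP => h Hh.
rewrite -det_tr.
have -> : (rowsub h (rowsub f A)^T)^T = mxsub f h A by apply/matrixP=> a b; rewrite !mxE.
exact: H.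
Qed.

(* The Cauchy-Binet formula before its terms are grouped by the image of [f]. *)
Lemma det_mulmx_rect (R : comNzRingType) i n (X : 'M[R]_(i, n)) (Y : 'M[R]_(n, i)) :
  \det (X *m Y) =
  \sum_(f : {ffun 'I_i -> 'I_n}) (\prod_a X a (f a)) * \det (rowsub f Y).
Proof.
transitivity (\sum_(s : 'S_i) \sum_(f : {ffun 'I_i -> 'I_n})
    (-1) ^+ s * \prod_a (X a (f a) * Y (f a) (s a))).
  apply: eq_bigr => s _; rewrite -big_distrr /=; congr (_ * _).
  rewrite -(bigA_distr_bigA (fun a j => X a j * Y j (s a))) /=.
  by apply: eq_bigr => a _; rewrite mxE.
rewrite exchange_big; apply: eq_bigr => f _.
rewrite /determinant big_distrr /=; apply: eq_bigr => s _.
rewrite big_split /= mulrCA; congr (_ * (_ * _)).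
by apply: eq_bigr => a _; rewrite mxE.
Qed.

Lemma dvd_minors_mull g i n n' k (A : 'M[{poly F}]_(n, k)) (P : 'M_(n', n)) :
  dvd_minors g i A -> dvd_minors g i (P *m A).
Proof.
move=> H f h; have -> : mxsub f h (P *m A) = rowsub f P *m colsub h A.
  by apply/matrixP=> a b; rewrite !mxE; apply: eq_bigr => l _; rewrite !mxE.
rewrite det_mulmx_rect; apply: (big_ind (fun x => g %| x)) => [|x y|u _].
- exact: dvdp0.
- exact: dvdp_add.
apply: dvdp_mull; have -> : rowsub u (colsub h A) = mxsub u h A.
  by apply/matrixP=> a b; rewrite !mxE.
exact: H.
Qed.

Lemma dvd_minors_tr g i n k (A : 'M[{poly F}]_(n, k)) :
  dvd_minors g i A -> dvd_minors g i A^T.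
Proof. by move=> H f h; rewrite -trmx_mxsub det_tr. Qed.

Lemma dvd_minors_mul g i n n' k k' (A : 'M[{poly F}]_(n, k)) (P : 'M_(n', n)) (Q : 'M_(k, k')) :
  dvd_minors g i A -> dvd_minors g i (P *m A *m Q).
Proof.
move=> H; rewrite -[_ *m Q]trmxK trmx_mul.
by apply/dvd_minors_tr/dvd_minors_mull/dvd_minors_tr/dvd_minors_mull.
Qed.

(* Equivalence of matrices of possibly different shapes: neither factor has to be
   square, so padding with zero rows and reindexing are covered. *)
Definition meqv n k n' k' (A : 'M[{poly F}]_(n, k)) (A' : 'M[{poly F}]_(n', k')) : Prop :=
  (exists P Q, A' = P *m A *m Q) /\ (exists P Q, A = P *m A' *m Q).

Lemma meqv_refl n k (A : 'M[{poly F}]_(n, k)) : meqv A A.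
Proof. by split; exists 1%:M, 1%:M; rewrite mul1mx mulmx1. Qed.

Lemma meqv_sym n k n' k' (A : 'M[{poly F}]_(n, k)) (A' : 'M_(n', k')) :
  meqv A A' -> meqv A' A.
Proof. by case. Qed.

Lemma meqv_trans n k n' k' n2 k2 (A : 'M[{poly F}]_(n, k)) (A' : 'M_(n', k'))
    (A2 : 'M_(n2, k2)) :
  meqv A A' -> meqv A' A2 -> meqv A A2.
Proof.
move=> [[P [Q E1]] [P' [Q' E2]]] [[R [S E3]] [R' [S' E4]]]; split.
  by exists (R *m P), (Q *m S); rewrite E3 E1 !mulmxA.
by exists (P' *m R'), (S' *m Q'); rewrite E2 E4 !mulmxA.
Qed.

Lemma meqv_block n k n' k' m l m' l' (A : 'M[{poly F}]_(n, k)) (A' : 'M_(n', k'))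
    (C : 'M[{poly F}]_(m, l)) (C' : 'M_(m', l')) :
  meqv A A' -> meqv C C' -> meqv (block_mx A 0 0 C) (block_mx A' 0 0 C').
Proof.
move=> [[P [Q ->]] [P' [Q' E2]]] [[R [S ->]] [R' [S' E4]]]; split.
  exists (block_mx P 0 0 R), (block_mx Q 0 0 S).
  by rewrite !mulmx_block !(mul0mx, mulmx0, addr0, add0r).
exists (block_mx P' 0 0 R'), (block_mx Q' 0 0 S').
by rewrite !mulmx_block !(mul0mx, mulmx0, addr0, add0r) -E2 -E4.
Qed.

Lemma meqv_delta n k n' k' (A : 'M[{poly F}]_(n, k)) (A' : 'M_(n', k')) g i :
  meqv A A' -> (g %| delta A i) = (g %| delta A' i).
Proof.
move=> [[P [Q E1]] [P' [Q' E2]]].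
by apply/dvd_minorsP/dvd_minorsP => H; [rewrite E1|rewrite E2]; apply: dvd_minors_mul.
Qed.

Definition diag_of (s : seq {poly F}) : 'M[{poly F}]_(size s) :=
  \matrix_(i, j) (s`_i *+ (i == j)).

Definition chain (s : seq {poly F}) : Prop :=
  (forall i, (i < size s)%N -> s`_i \is monic) /\
  (forall i j, (i <= j < size s)%N -> s`_i %| s`_j).

Lemma incr_sel_ge i m (f : {ffun 'I_i -> 'I_m}) (a : 'I_i) : incr_sel f -> (a <= f a)%N.
Proof.
move=> /forallP H; case: a => a; elim: a => // a IH ai /=.
have ai' : (a < i)%N by apply: ltnW.
apply: leq_ltn_trans (IH ai') _.
by have /forallP/(_ (Ordinal ai))/implyP := H (Ordinal ai'); apply => /=.
Qed.

(** An increasing selection has [f a >= a], so along the chain every term in the expansion of a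
    minor is divisible by the product of the first i entries, and the leading minor equals that
    product. *)
Lemma delta_diag_of s i g : chain s -> (i <= size s)%N ->
  (g %| delta (diag_of s) i) = (g %| \prod_(j < i) s`_j).
Proof.
move=> [_ ch] si; apply/dvd_minorsP/idP => [H|H].
  pose w := widen_ord si.
  have <- : \det (mxsub w w (diag_of s)) = \prod_(j < i) s`_j; last exact: H.
  have -> : mxsub w w (diag_of s) = diag_mx (\row_j s`_j).
    by apply/matrixP=> a b; rewrite !mxE.
  by rewrite det_diag; apply: eq_bigr => a _; rewrite !mxE.
apply/dvd_minorsP/dvdp_delta => f h Hf Hh.
apply: (big_ind (fun x => g %| x)) => [|x y|u _]; [exact: dvdp0|exact: dvdp_add|].
apply/dvdp_mull/(dvdp_trans H).
elim/big_ind2: _ => // [x x' y y'|a _]; first exact: dvdp_mul.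
by rewrite !mxE; case: eqP => _; rewrite ?dvdp0 // ch // incr_sel_ge //=.
Qed.

Lemma meqv_invf n k (A : 'M[{poly F}]_(n, k)) s i : chain s -> meqv A (diag_of s) ->
  (i < size s)%N -> Defs.invf A i.+1 = s`_i.
Proof.
move=> ch AE si.
have mon j : (j <= size s)%N -> \prod_(l < j) s`_l \is monic.
  move=> sj; apply: monic_prod => l _; apply: ch.1.
  exact: leq_trans sj.
have E j : (j <= size s)%N -> delta A j = \prod_(l < j) s`_l.
  move=> sj; have eq : delta A j %= \prod_(l < j) s`_l.
    have H g : (g %| delta A j) = (g %| \prod_(l < j) s`_l).
      by rewrite (meqv_delta _ _ AE) delta_diag_of.
    by rewrite /eqp H dvdpp -H dvdpp.
  apply/eqP; rewrite -eqp_monic ?mon //.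
  move: eq;  rewrite /delta /monicize; set p := foldr _ _ _.
  have [->|p0] := eqVneq p 0.
    by rewrite scaler0 eqp_sym eqp0 (negPf (monic_neq0 (mon _ sj))).
  by move=> _; rewrite monicE lead_coefZ mulVf // lead_coef_eq0.
rewrite /Defs.invf /= !E ?(ltnW si) // big_ord_recr /= mulrC mulpK //.
exact/monic_neq0/mon/ltnW.
Qed.

Lemma meqv_reindex n k n' k' (A : 'M[{poly F}]_(n, k)) (A' : 'M_(n', k'))
    (f : 'I_n' -> 'I_n) (f' : 'I_n -> 'I_n') (h : 'I_k' -> 'I_k) (h' : 'I_k -> 'I_k') :
  A' = mxsub f h A -> A = mxsub f' h' A' -> meqv A A'.
Proof.
suff H m l m' l' (X : 'M[{poly F}]_(m, l)) (u : 'I_m' -> 'I_m) (v : 'I_l' -> 'I_l) :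
    exists P Q, mxsub u v X = P *m X *m Q by move=> E1 E2; split; [rewrite {1}E1|rewrite {1}E2].
exists (rowsub u 1%:M), (colsub v 1%:M).
by rewrite mul_rowsub_mx mul1mx mulmx_colsub mulmx1; apply/matrixP=> a b; rewrite !mxE.
Qed.

Lemma meqv_blockC n k n' k' (A : 'M[{poly F}]_(n, k)) (A' : 'M_(n', k')) :
  meqv (block_mx A 0 0 A') (block_mx A' 0 0 A).
Proof.
pose sw a b (i : 'I_(a + b)) : 'I_(b + a) :=
  match split i with inl j => rshift b j | inr j => lshift a j end.
have swl a b (i : 'I_a) : @sw a b (lshift b i) = rshift b i.
  by rewrite /sw (unsplitK (inl i)).
have swr a b (i : 'I_b) : @sw a b (rshift a i) = lshift a i.
  by rewrite /sw (unsplitK (inr i)).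
apply: (@meqv_reindex _ _ _ _ _ _ (@sw _ _) (@sw _ _) (@sw _ _) (@sw _ _));
 apply/matrixP=> i j; rewrite [RHS]mxE;
 case: (split_ordP i) => i' ->; case: (split_ordP j) => j' ->;
 by rewrite ?swl ?swr ?block_mxEul ?block_mxEur ?block_mxEdl ?block_mxEdr ?mxE.
Qed.

Lemma meqv_diag_cat s t :
  meqv (block_mx (diag_of s) 0 0 (diag_of t)) (diag_of (s ++ t)).
Proof.
pose u := cast_ord (size_cat s t); pose u' := cast_ord (esym (size_cat s t)).
have E : diag_of (s ++ t) = mxsub u u (block_mx (diag_of s) 0 0 (diag_of t)).
  apply/matrixP=> i j; rewrite !mxE -(inj_eq (@cast_ord_inj _ _ (size_cat s t))) -/u nth_cat.
  rewrite -[in LHS]/(nat_of_ord (u i)).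
  case: (splitP (u i)) => i' Ei; have {}Ei : val i = _ := Ei; rewrite mxE;
    case: (splitP (u j)) => j' Ej; have {}Ej : val j = _ := Ej;
    rewrite !mxE -(inj_eq val_inj) /= Ei Ej.
  - by [].
  - by rewrite ltn_eqF // (leq_trans (ltn_ord i')) // leq_addr.
  - by rewrite gtn_eqF // (leq_trans (ltn_ord j')) // leq_addr.
  by rewrite eqn_add2l addKn.
apply: (@meqv_reindex _ _ _ _ _ _ u u' u u') => //.
by rewrite E; apply/matrixP=> i j; rewrite [RHS]mxE [RHS]mxE /u /u' !cast_ordKV.
Qed.

Lemma meqv_1_diag r : meqv (1%:M : 'M[{poly F}]_r) (diag_of (nseq r 1)).
Proof.
pose u := cast_ord (size_nseq r (1 : {poly F})); pose u' := cast_ord (esym (size_nseq r (1 : {poly F}))).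
apply: (@meqv_reindex _ _ _ _ _ _ u u' u u'); apply/matrixP=> i j; rewrite !mxE.
  rewrite nth_nseq -[X in (X < r)%N]/(nat_of_ord (u i)) ltn_ord.
  by rewrite (inj_eq (@cast_ord_inj _ _ _)).
by rewrite nth_nseq /= ltn_ord (inj_eq (@cast_ord_inj _ _ _)).
Qed.

Lemma meqv_scalar_diag (p : {poly F}) : meqv (p%:M : 'M_1) (diag_of [:: p]).
Proof.
have -> : diag_of [:: p] = p%:M; last exact: meqv_refl.
by apply/matrixP=> i j; rewrite !mxE !ord1.
Qed.

Definition invs n k (B : 'M[F]_(n, k)) : seq {poly F} :=
  mkseq (fun i => Defs.invf (xImB B) i.+1) k.

Lemma size_invs n k (B : 'M[F]_(n, k)) : size (invs B) = k.
Proof. exact: size_mkseq. Qed.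

Lemma has_invfE n k (B : 'M[F]_(n, k)) p : size p = k -> has_invf B p = (invs B == p).
Proof.
move=> sp; apply/forallP/eqP => [H|<- i]; last by rewrite nth_mkseq.
apply: (@eq_from_nth _ 0); rewrite size_invs // => i ik.
by rewrite nth_mkseq //; apply/eqP/(H (Ordinal ik)).
Qed.

Lemma invs_meqv n k (B : 'M[F]_(n, k)) s : chain s -> size s = k ->
  meqv (xImB B) (diag_of s) -> invs B = s.
Proof.
move=> ch sk E; apply: (@eq_from_nth _ 0); rewrite size_invs // => i ik.
by rewrite nth_mkseq // (meqv_invf ch E) // sk.
Qed.

End Minors.

(** * Annihilators of vectors *)

Section PolyAction.
Variable F : finFieldType.
Implicit Types (g h p : {poly F}) (d m : nat).

(* Unlike [horner_mx], this also makes sense for [d = 0]. *)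
Definition mx_eval d (C : 'M[F]_d) g : 'M[F]_d := \sum_(i < size g) g`_i *: C ^+ i.

Lemma mx_evalE d (C : 'M[F]_d.+1) g : mx_eval C g = horner_mx C g.
Proof.
rewrite -[g in RHS]coefK poly_def raddf_sum; apply: eq_bigr => i _.
by rewrite /= -mul_polyC rmorphM rmorphXn /= horner_mx_X horner_mx_C -mulmxE mul_scalar_mx.
Qed.

Lemma mx_eval_wide d (C : 'M[F]_d) g n : (size g <= n)%N ->
  mx_eval C g = \sum_(i < n) g`_i *: C ^+ i.
Proof.
move=> gn; rewrite /mx_eval (big_ord_widen _ (fun i => g`_i *: C ^+ i) gn) big_mkcond /=.
by apply: eq_bigr => i _; case: ltnP => // H; rewrite nth_default // scale0r.
Qed.

Lemma mx_evalM d (C : 'M[F]_d) g h : mx_eval C (g * h) = mx_eval C g *m mx_eval C h.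
Proof. by case: d C => [|d] C; [rewrite !flatmx0 | rewrite !mx_evalE rmorphM]. Qed.

Lemma mx_evalMC d (C : 'M[F]_d) g h : mx_eval C g *m mx_eval C h = mx_eval C h *m mx_eval C g.
Proof. by rewrite -!mx_evalM mulrC. Qed.

Lemma mx_evalD d (C : 'M[F]_d) g h : mx_eval C (g + h) = mx_eval C g + mx_eval C h.
Proof. by case: d C => [|d] C; [rewrite !flatmx0 | rewrite !mx_evalE rmorphD]. Qed.

Lemma mx_eval1 d (C : 'M[F]_d) : mx_eval C 1 = 1%:M.
Proof. by case: d C => [|d] C; [rewrite !flatmx0 | rewrite mx_evalE rmorph1]. Qed.

Lemma mx_evalXn d (C : 'M[F]_d) n : mx_eval C 'X^n = C ^+ n.
Proof.
by case: d C => [|d] C; [rewrite [LHS]flatmx0 [RHS]flatmx0 | rewrite mx_evalE rmorphXn /= horner_mx_X].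
Qed.

Lemma mx_eval_comm m d (K : 'M[F]_(m, d)) (c : 'M_m) (C : 'M_d) g :
  K *m C = c *m K -> K *m mx_eval C g = mx_eval c g *m K.
Proof.
move=> KC; rewrite /mx_eval mulmx_sumr mulmx_suml; apply: eq_bigr => i _.
rewrite -scalemxAl -scalemxAr; congr (_ *: _).
elim: (i : nat) => [|j IH]; first by rewrite !expr0 -!idmxE mulmx1 mul1mx.
by rewrite !exprS -!mulmxE mulmxA KC -!mulmxA IH.
Qed.

Lemma mx_eval_block d d' (c : 'M[F]_d) (C : 'M[F]_d') g :
  mx_eval (block_mx c 0 0 C) g = block_mx (mx_eval c g) 0 0 (mx_eval C g).
Proof.
set B := block_mx c 0 0 C.
have E1 : row_mx 1%:M 0 *m B = c *m row_mx 1%:M 0.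
  by rewrite mul_row_block mul_mx_row !(mul1mx, mulmx1, mul0mx, mulmx0, addr0).
have E2 : row_mx 0 1%:M *m B = C *m row_mx 0 1%:M.
  by rewrite mul_row_block mul_mx_row !(mul1mx, mulmx1, mul0mx, mulmx0, addr0, add0r).
rewrite -[LHS]mul1mx.
rewrite [1%:M]scalar_mx_block /block_mx mul_col_mx (mx_eval_comm g E1) (mx_eval_comm g E2).
by rewrite !mul_mx_row !mulmx1 !mulmx0.
Qed.

Lemma dvdp_mx_eval0 d (C : 'M[F]_d) p g : mx_eval C p = 0 -> p %| g -> mx_eval C g = 0.
Proof. by move=> Cp /dvdpP[h ->]; rewrite mx_evalM Cp mulmx0. Qed.

Lemma dvdp_row_eval0 d (C : 'M[F]_d) m (v : 'M_(m, d)) p g :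
  v *m mx_eval C p = 0 -> p %| g -> v *m mx_eval C g = 0.
Proof. by move=> Cp /dvdpP[h ->]; rewrite mulrC mx_evalM mulmxA Cp mul0mx. Qed.

(** Bezout: the polynomials annihilating [v] form an ideal. [egcdp] gives the gcd only up to
    scalars, hence the division by [a]. *)
Lemma gcdp_row_eval0 d (C : 'M[F]_d) m (v : 'M_(m, d)) p g :
  v *m mx_eval C p = 0 -> v *m mx_eval C g = 0 -> v *m mx_eval C (gcdp p g) = 0.
Proof.
move=> vp vg; have /eqpP[[a b] /= /andP[a0 b0]] := egcdpE p g => E.
have H : v *m mx_eval C (a *: gcdp p g) = 0.
  rewrite E -mul_polyC mx_evalM mx_evalMC mulmxA mx_evalD mulmxDr mx_evalM mx_evalM.
  by rewrite !(mx_evalMC _ _ p, mx_evalMC _ _ g) !mulmxA vp vg !mul0mx addr0 mul0mx.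
rewrite -[gcdp p g]scale1r -(mulVf a0) -scalerA -mul_polyC mx_evalM mx_evalMC mulmxA H.
by rewrite mul0mx.
Qed.

Lemma ex_mx_minpoly d (C : 'M[F]_d) :
  exists2 p, p \is monic /\ mx_eval C p = 0 & forall g, mx_eval C g = 0 -> p %| g.
Proof.
case: d C => [|d] C.
  by exists 1; [split; [exact: monic1|exact: flatmx0]|move=> g _; exact: dvd1p].
exists (mxminpoly C) => [|g]; rewrite mx_evalE; last exact: mxminpoly_min.
by rewrite mxminpoly_monic mx_root_minpoly.
Qed.

Lemma ex_irred_dvdp p : (1 < size p)%N -> exists f, [/\ f \is monic, irreducible_poly f & f %| p].
Proof.
move=> p1; have p0 : p != 0 by rewrite -size_poly_gt0 ltnW.
(* Polynomials of bounded size are coded as row vectors, which makes the search for a nonconstant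
   divisor of least size decidable. *)
pose P n := [exists v : 'rV[F]_(size p), [&& (1 < n)%N, size (rVpoly v) == n & rVpoly v %| p]].
have exP : exists n, P n.
  exists (size p); apply/existsP; exists (poly_rV p).
  by rewrite poly_rV_K // p1 eqxx dvdpp.
case: (ex_minnP exP) => n /existsP[v /and3P[n1 /eqP sv vp]] Hmin.
set f := rVpoly v in sv vp.
have f0 : f != 0 by rewrite -size_poly_gt0 sv ltnW.
exists ((lead_coef f)^-1 *: f).
have lf : (lead_coef f)^-1 != 0 by rewrite invr_eq0 lead_coef_eq0.
split; [by rewrite monicE lead_coefZ mulVf // lead_coef_eq0| |by rewrite dvdpZl].
split; first by rewrite size_scale // sv.
move=> q q1; rewrite dvdpZr // => qf.
have q0 : q != 0 by apply: dvdpN0 qf f0.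
rewrite eqp_sym (eqp_trans (eqp_scale _ lf)) // eqp_sym -dvdp_size_eqp // eqn_leq dvdp_leq //=.
rewrite sv; apply: Hmin; apply/existsP; exists (poly_rV q).
have qp := dvdp_trans qf vp.
rewrite poly_rV_K ?dvdp_leq // eqxx qp andbT /=.
by rewrite andbT ltn_neqAle eq_sym q1 size_poly_gt0.
Qed.

Lemma irred_coprimep f g : irreducible_poly f -> coprimep f g = ~~ (f %| g).
Proof.
case=> f1 fi; apply/idP/idP => [cfg|nfg].
  apply/negP => fg; move: cfg; rewrite /coprimep.
  by rewrite (eqp_size (dvdp_gcd_idl fg)) gtn_eqF.
rewrite /coprimep; apply/negPn/negP => g1; move: nfg.
by rewrite -(eqp_dvdl _ (fi _ g1 (dvdp_gcdl f g))) dvdp_gcdr.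
Qed.

Lemma irred_dvdpM f g h : irreducible_poly f -> (f %| g * h) = (f %| g) || (f %| h).
Proof.
move=> fi; have [fg|nfg] /= := boolP (f %| g); first exact: dvdp_mulr.
by rewrite Gauss_dvdpr // irred_coprimep.
Qed.

Lemma irred_monic_dvdp f g : irreducible_poly f -> irreducible_poly g ->
  f \is monic -> g \is monic -> (f %| g) = (f == g).
Proof.
move=> [f1 fi] [g1 gi] fm gm; apply/idP/eqP => [fg|->]; last exact: dvdpp.
by apply/eqP; rewrite -eqp_monic // gi // gtn_eqF.
Qed.

Lemma irred_dvdp_exp f g n : irreducible_poly f -> f %| g ^+ n -> f %| g.
Proof.
move=> fi; elim: n => [|n IH]; last by rewrite exprS irred_dvdpM // => /orP[//|/IH].
by rewrite expr0 dvdp1; case: fi => f1 _; rewrite gtn_eqF.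
Qed.

Lemma exp_factor p f : p != 0 -> irreducible_poly f ->
  exists n b, p = f ^+ n * b /\ ~~ (f %| b).
Proof.
move=> + fi; have [f1 _] := fi; have [n] := ubnP (size p); elim: n p => // n IH p pn p0.
have [/dvdpP[g E]|fp] := boolP (f %| p); last by exists 0%N, p; rewrite expr0 mul1r.
have g0 : g != 0 by apply: contraNneq p0 => g0; rewrite E g0 mul0r.
have f0 : f != 0 by rewrite -size_poly_gt0 ltnW.
have [|m [b [Eb fb]]] := IH g _ g0.
  move: pn f1; rewrite E size_mul //; move: (size (polyseq f)) (size (polyseq g)) => a b; lia.
by exists m.+1, b; rewrite E Eb exprS mulrC mulrA.
Qed.

Definition irred_divisors p (S : seq {poly F}) : Prop :=
  uniq S /\ forall f, f \in S <-> [/\ f \is monic, irreducible_poly f & f %| p].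

Lemma ex_irred_divisors p : p != 0 -> exists S, irred_divisors p S.
Proof.
have [n] := ubnP (size p); elim: n p => // n IH p pn p0.
have [p1|p1] := leqP (size p) 1.
  exists [::]; split=> // f; split=> // -[_ [f1 _] /dvdp_leq].
  by move=> /(_ p0) /leq_trans /(_ p1); rewrite leqNgt f1.
have [f [fm fi /dvdpP[g E]]] := ex_irred_dvdp p1.
have g0 : g != 0 by apply: contraNneq p0 => g0; rewrite E g0 mul0r.
have [|S [_ HS]] := IH g _ g0.
  case: fi => f1 _; move: pn f1; rewrite E size_Mmonic //.
  by move: (size (polyseq f)) (size (polyseq g)) => a b; lia.
exists (undup (f :: S)); split; first exact: undup_uniq.
move=> h; rewrite mem_undup inE; split.
  case/orP => [/eqP ->|/HS[hm hi hg]]; first by split=> //; rewrite E dvdp_mulIr.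
  by split=> //; rewrite E dvdp_mulr.
case=> hm hi; rewrite E irred_dvdpM // => /orP[hg|].
  by apply/orP; right; apply/HS.
by rewrite irred_monic_dvdp // => ->.
Qed.

(* A divisor of [p] annihilating [v] that is not associate to [p] divides some [p %/ f]. *)
Lemma ann_criterion d (C : 'M[F]_d) (v : 'rV_d) p S : p != 0 -> irred_divisors p S ->
  v *m mx_eval C p = 0 ->
  (forall f, f \in S -> v *m mx_eval C (p %/ f) != 0) ->
  forall g, v *m mx_eval C g = 0 -> p %| g.
Proof.
move=> p0 [_ HS] vp vf g vg; set D := gcdp p g.
have vD : v *m mx_eval C D = 0 by apply: gcdp_row_eval0.
have /dvdpP[E pE] : D %| p by apply: dvdp_gcdl.
have E0 : E != 0 by apply: contraNneq p0 => E0; rewrite pE E0 mul0r.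
have D0 : D != 0 by apply: contraNneq p0 => D0; rewrite pE D0 mulr0.
have [E1|/ex_irred_dvdp[f [fm fi fE]]] := leqP (size E) 1.
  apply: dvdp_trans (dvdp_gcdr p g); rewrite -/D pE -[X in _ %| X]mul1r dvdp_mul2r //.
  by rewrite dvdp1 eqn_leq E1 size_poly_gt0.
have fS : f \in S by apply/HS; split=> //; rewrite pE dvdp_mulr.
have /eqP[] := vf _ fS; apply: dvdp_row_eval0 vD _.
by rewrite pE -divp_mulAC // dvdp_mulIr.
Qed.

(** Minimality of p gives, for each prime f of p, a vector not killed by (p / f)(C). They are merged
    one prime at a time: with p = f^n b and f not dividing b, adding [w *m mx_eval C b] repairs f
    and is invisible to the other primes, since these divide b. *)
Lemma ex_ann_vector d (C : 'M[F]_d) p :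
  p != 0 -> mx_eval C p = 0 -> (forall g, mx_eval C g = 0 -> p %| g) ->
  exists v : 'rV_d, forall g, v *m mx_eval C g = 0 -> p %| g.
Proof.
move=> p0 Cp Cmin; have [S HS] := ex_irred_divisors p0.
suff [v Hv] : exists v : 'rV_d, forall f, f \in S -> v *m mx_eval C (p %/ f) != 0.
  by exists v; apply: (ann_criterion p0 HS) => //; rewrite Cp mulmx0.
have [Su SP] := HS.
have w_ex f : f \in S -> exists w : 'rV_d, w *m mx_eval C (p %/ f) != 0.
  case/SP => fm [f1 _] fp; apply/existsP; apply: contraT; rewrite negb_exists => /forallP H.
  have /Cmin : mx_eval C (p %/ f) = 0.
    by apply/row_matrixP => i; rewrite row0 rowE; apply/eqP; have := H (delta_mx 0 i); rewrite negbK.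
  have f0 := monic_neq0 fm.
  have pf0 : p %/ f != 0 by rewrite dvdp_div_eq0.
  move=> /(dvdp_leq pf0); rewrite size_divp //.
  by move: p0 f1; rewrite -size_poly_gt0; move: (size (polyseq f)) (size (polyseq p)) => a b; lia.
suff H T : uniq T -> {subset T <= S} ->
    exists v : 'rV_d, forall f, f \in T -> v *m mx_eval C (p %/ f) != 0 by exact: H.
elim: T => [|f T IH] /=; first by exists 0.
move=> /andP[fT Tu] TS; have [//||v Hv] := IH.
  by move=> h hT; apply: TS; rewrite inE hT orbT.
have fS : f \in S by rewrite TS ?mem_head.
have [vf|vf] := eqVneq (v *m mx_eval C (p %/ f)) 0; last first.
  by exists v => h; rewrite inE => /orP[/eqP -> //|/Hv].
have [w wf] := w_ex _ fS; have /SP[fm fi fp] := fS; have f0 := monic_neq0 fm.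
have [n [b [E fb]]] := exp_factor p0 fi.
exists (v + w *m mx_eval C b) => h; rewrite inE mulmxDl => /orP[/eqP ->|hT].
  rewrite vf add0r -mulmxA -mx_evalM mulrC mx_evalM mulmxA; apply: contraNneq wf => H.
  have H2 : w *m mx_eval C (p %/ f) *m mx_eval C f = 0.
    by rewrite -mulmxA -mx_evalM divpK // Cp mulmx0.
  have := gcdp_row_eval0 H2 H; move/dvdp_row_eval0 => /(_ 1).
  rewrite mx_eval1 mulmx1 => -> //.
  by rewrite dvdp1 -[_ == _]/(coprimep f b) irred_coprimep.
have /SP[hm hi hp] : h \in S by apply: TS; rewrite inE hT orbT.
have hb : h %| b.
  move: hp; rewrite E irred_dvdpM // => /orP[/(irred_dvdp_exp hi)|//].
  by rewrite irred_monic_dvdp // => /eqP hf; rewrite -hf hT in fT.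
rewrite [X in _ + X](_ : _ = 0) ?addr0 ?Hv //.
rewrite -mulmxA -mx_evalM E -divp_mulA // mulrCA mulrA -E mx_evalM Cp mul0mx mulmx0 //.
Qed.

End PolyAction.

(** * Krylov matrices and companion matrices *)

Section Krylov.
Variable F : finFieldType.
Implicit Types (g h p : {poly F}) (d m : nat).

Lemma xImB_sq d (C : 'M[F]_d) : xImB C = 'X%:M - map_mx polyC C.
Proof. by apply/matrixP=> i j; rewrite !mxE -(inj_eq val_inj) /=; case: ifP => _. Qed.

Lemma xImB_conj d (C C1 Q : 'M[F]_d) : Q \in unitmx -> Q *m C = C1 *m Q ->
  meqv (xImB C) (xImB C1).
Proof.
move=> Qu QC; have E : map_mx polyC Q *m xImB C = xImB C1 *m map_mx polyC Q.
  by rewrite !xImB_sq mulmxBr mulmxBl -!map_mxM QC scalar_mxC.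
have QQ : map_mx polyC (invmx Q) *m map_mx polyC Q = 1%:M :> 'M_d.
  by rewrite -map_mxM mulVmx // map_mx1.
have QQ' : map_mx polyC Q *m map_mx polyC (invmx Q) = 1%:M :> 'M_d.
  by rewrite -map_mxM mulmxV // map_mx1.
split.
  by exists (map_mx polyC Q), (map_mx polyC (invmx Q)); rewrite E -mulmxA QQ' mulmx1.
by exists (map_mx polyC (invmx Q)), (map_mx polyC Q); rewrite -mulmxA -E mulmxA QQ mul1mx.
Qed.

Lemma xImB_block d d' (C : 'M[F]_d) (D : 'M_d') :
  xImB (block_mx C 0 0 D) = block_mx (xImB C) 0 0 (xImB D).
Proof.
rewrite !xImB_sq map_block_mx !map_mx0 scalar_mx_block opp_block_mx add_block_mx.
by rewrite !oppr0 !addr0.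
Qed.

(* [a + w *m x] is the Schur complement: the equation on [x] says x = - L^-1 u. *)
Lemma meqv_schur m (u : 'M[{poly F}]_(m, 1)) (L : 'M_m) (a : 'M_1) (w : 'M_(1, m)) x :
  L \in unitmx -> u + L *m x = 0 ->
  meqv (block_mx u L a w) (block_mx (a + w *m x) 0 0 (1%:M : 'M_m)).
Proof.
move=> Lu E.
have E1 : block_mx u L a w *m block_mx 1%:M 0 x 1%:M = block_mx 0 L (a + w *m x) w.
  by rewrite mulmx_block !mulmx1 !mulmx0 !add0r E.
have E2 : block_mx 1%:M 0 x 1%:M *m block_mx 1%:M 0 (- x) 1%:M = 1%:M.
  by rewrite mulmx_block !(mulmx1, mul1mx, mulmx0, mul0mx, addr0, add0r) addrN -scalar_mx_block.
split.
  exists (block_mx (- (w *m invmx L)) 1%:M (invmx L) 0), (block_mx 1%:M 0 x 1%:M).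
  rewrite -mulmxA E1 mulmx_block !(mulmx1, mul1mx, mulmx0, mul0mx, addr0, add0r).
  by rewrite mulVmx // mulNmx -mulmxA mulVmx // mulmx1 addNr.
exists (block_mx 0 L 1%:M w), (block_mx 1%:M 0 (- x) 1%:M).
rewrite [block_mx 0 L _ _ *m _]mulmx_block.
rewrite !(mulmx1, mul1mx, mulmx0, mul0mx, addr0, add0r) -E1 -mulmxA E2 mulmx1 //.
Qed.

(** Multiplication by x on F[x]/(p), for p monic of degree m + 1, in the basis 1, x, ..., x^m and
    acting on row vectors. *)
Definition compan m p : 'M[F]_m.+1 :=
  \matrix_(i, j) if i == m :> nat then - p`_j else (i.+1 == j)%:R.

Definition krylov m d (v : 'rV[F]_d) (C : 'M[F]_d) : 'M[F]_(m.+1, d) :=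
  \matrix_(i < m.+1) (v *m C ^+ i).

Lemma mul_krylov m d (v : 'rV[F]_d) (C : 'M_d) (a : 'rV_m.+1) :
  a *m krylov m v C = v *m mx_eval C (rVpoly a).
Proof.
rewrite mulmx_sum_row (mx_eval_wide _ (size_poly _ _)) mulmx_sumr.
by apply: eq_bigr => i _; rewrite rowK -scalemxAr coef_rVpoly_ord.
Qed.

Section Companion.
Variables (m : nat) (p : {poly F}).
Hypotheses (pm : p \is monic) (sp : size p = m.+2).
Let c := compan m p.

Lemma row_compan_lt (i : 'I_m.+1) (im : (i.+1 < m.+1)%N) :
  row i c = delta_mx 0 (Ordinal im).
Proof.
apply/rowP=> j; rewrite !mxE ltn_eqF // eq_sym -(inj_eq val_inj) //=.
Qed.

Lemma row_compan_last : row ord_max c = - \row_j p`_j.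
Proof. by apply/rowP=> j; rewrite !mxE eqxx. Qed.

Lemma delta_compan i (im : (i < m.+1)%N) :
  delta_mx 0 0 *m c ^+ i = delta_mx 0 (Ordinal im) :> 'rV_m.+1.
Proof.
elim: i im => [|i IH] im.
  by rewrite expr0 mulmx1; congr delta_mx; apply: val_inj.
have im' := ltnW im.
by rewrite exprSr -mulmxE mulmxA (IH im') -rowE (row_compan_lt (i := Ordinal im')).
Qed.

Lemma delta_mx_eval h : (size h <= m.+1)%N ->
  delta_mx 0 0 *m mx_eval c h = poly_rV h :> 'rV_m.+1.
Proof.
move=> hm; rewrite (mx_eval_wide _ hm) mulmx_sumr [RHS]row_sum_delta.
apply: eq_bigr => i _; rewrite -scalemxAr (delta_compan (ltn_ord i)) mxE.
by congr (_ *: delta_mx _ _); apply: val_inj.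
Qed.

Lemma krylov_compan d (v : 'rV[F]_d) (C : 'M_d) :
  v *m mx_eval C p = 0 -> krylov m v C *m C = c *m krylov m v C.
Proof.
move=> vp; apply/row_matrixP => i; rewrite !row_mul rowK -mulmxA mulmxE -exprSr.
have [im|im] := ltnP i m.
  by rewrite (row_compan_lt (i := i) im) -rowE rowK.
have -> : i = ord_max by apply/val_inj/eqP; rewrite eqn_leq im -ltnS ltn_ord.
rewrite row_compan_last mulNmx mul_krylov; apply/eqP; rewrite -addr_eq0 addrC -vp.
apply/eqP; rewrite -mulmxDr; congr (_ *m _).
have -> : mx_eval C p = mx_eval C (rVpoly (\row_(j < m.+1) p`_j) + 'X^(m.+1)).
  congr mx_eval; symmetry.
  rewrite -[RHS]coefK sp poly_def big_ord_recr /= -poly_def.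
  have := monicP pm; rewrite /lead_coef sp /= => ->; rewrite scale1r; congr (_ + _).
  apply/polyP=> j; rewrite coef_rVpoly coef_poly; case: insubP => [i' _ <-|/negPf->//].
  by rewrite mxE ltn_ord.
by rewrite mx_evalD mx_evalXn.
Qed.

Lemma delta_compan_p : delta_mx 0 0 *m mx_eval c p = 0 :> 'rV_m.+1.
Proof.
rewrite (mx_eval_wide _ (n := m.+2)) ?sp // mulmx_sumr big_ord_recr /=.
have := monicP pm; rewrite /lead_coef sp /= => ->; rewrite scale1r.
rewrite exprSr -mulmxE mulmxA (delta_compan (ltnSn m)) -rowE.
rewrite (_ : Ordinal _ = ord_max) ?row_compan_last; last exact: val_inj.
apply/eqP; rewrite subr_eq0 [X in _ == X]row_sum_delta; apply/eqP.
apply: eq_bigr => i _; rewrite -scalemxAr (delta_compan (ltn_ord i)) mxE.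
by congr (_ *: delta_mx _ _); apply: val_inj.
Qed.

Lemma compan_ann : mx_eval c p = 0.
Proof.
apply/row_matrixP=> i; rewrite row0 rowE.
have -> : delta_mx 0 i = delta_mx 0 0 *m c ^+ i :> 'rV_m.+1.
  by rewrite (delta_compan (ltn_ord i)); congr delta_mx; apply: val_inj.
by rewrite -mx_evalXn -mulmxA mx_evalMC mulmxA delta_compan_p mul0mx.
Qed.

(** The first unit vector is the class of 1 in F[x]/(p), and h(c) sends it to the remainder of h. *)
Lemma compan_dvdp h : (delta_mx 0 0 *m mx_eval c h == 0 :> 'rV_m.+1) = (p %| h).
Proof.
have p0 := monic_neq0 pm.
rewrite {1}(divp_eq h p) mx_evalD mulmxDr.
rewrite (dvdp_row_eval0 delta_compan_p (dvdp_mulIr _ _)) add0r /dvdp.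
have sz : (size (h %% p)%R <= m.+1)%N by rewrite -ltnS -sp ltn_modp.
rewrite delta_mx_eval //; apply/eqP/eqP => [H|->]; last exact: linear0.
by rewrite -(poly_rV_K sz) H linear0.
Qed.

Lemma compan_eval0 h : mx_eval c h = 0 <-> p %| h.
Proof.
split=> [H|]; last exact: dvdp_mx_eval0 compan_ann.
by rewrite -compan_dvdp H mulmx0.
Qed.

Definition ker_card d (C : 'M[F]_d) g : nat := #|[set v : 'rV_d | v *m mx_eval C g == 0]|.

(** In F[x]/(p) the polynomial g kills exactly the multiples of p / gcd(g, p), a space of dimension
    deg gcd(g, p). *)
Lemma ker_card_compan g : ker_card c g = (#|F| ^ (size (gcdp g p)).-1)%N.
Proof.
have p0 := monic_neq0 pm.
set D := gcdp g p; have Dp : D %| p by apply: dvdp_gcdr.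
have D0 : D != 0 by apply: dvdpN0 Dp p0.
set p1 := p %/ D; have pE : p = p1 * D by rewrite divpK.
have p10 : p1 != 0 by rewrite dvdp_div_eq0.
have szE : ((size p1).-1 + (size D).-1 = m.+1)%N.
  have := sp; rewrite {1}pE size_mul //; move: p10 D0; rewrite -!size_poly_gt0.
  by move: (size (polyseq p1)) (size (polyseq D)) => a b; lia.
have E v : (v *m mx_eval c g == 0) = (p1 %| rVpoly v).
  rewrite -{1}[v]rVpolyK -(delta_mx_eval (size_poly _ _)) -mulmxA -mx_evalM compan_dvdp.
  rewrite -[RHS](dvdp_mul2r _ _ D0) -pE (eqp_dvdr _ (mulp_gcdr _ _ _)) dvdp_gcd.
  by rewrite dvdp_mulIr andbT.
have sr n (w : 'rV[F]_n) : (size (rVpoly w) <= n)%N by apply: size_poly.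
have sw (w : 'rV[F]_(size D).-1) : (size (p1 * rVpoly w)%R <= m.+1)%N.
  apply: leq_trans (size_polyMleq _ _) _; have := sr _ w.
  move: szE p10; rewrite -!size_poly_gt0.
  by move: (size (polyseq p1)) (size (polyseq D)) (size (polyseq (rVpoly w))) => a b e; lia.
pose f (w : 'rV[F]_(size D).-1) : 'rV[F]_m.+1 := poly_rV (p1 * rVpoly w).
have -> : ker_card c g = #|f @: setT|.
  apply: eq_card => v; rewrite inE E; apply/idP/imsetP => [/dvdpP[k Ek]|[w _ ->]].
    have sk : (size k <= (size D).-1)%N.
      have [->|k0] := eqVneq k 0; first by rewrite size_poly0.
      have := sr _ v; rewrite Ek size_mul //; move: szE p10 (k0); rewrite -!size_poly_gt0.
      by move: (size (polyseq p1)) (size (polyseq D)) (size (polyseq k)) => a b e; lia.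
    by exists (poly_rV k) => //; rewrite /f poly_rV_K // mulrC -Ek rVpolyK.
  by rewrite poly_rV_K ?dvdp_mulIl.
rewrite card_imset ?cardsT ?card_mx ?mul1n // => w w' /(congr1 rVpoly).
by rewrite !poly_rV_K // => /(mulfI p10) /(can_inj (@rVpolyK _ _)).
Qed.

Lemma meqv_compan : meqv (xImB c) (diag_of (nseq m 1 ++ [:: p])).
Proof.
(* Rows are read as m + 1 and columns as 1 + m, so that the blocks separate the first column and the
   last row from the rest. *)
pose f := cast_ord (addn1 m); pose f' := cast_ord (esym (addn1 m)).
set A : 'M[{poly F}]_(1 + m) := xImB c.
have AE : meqv A (mxsub f id A).
  apply: (@meqv_reindex _ _ _ _ _ _ _ f f' id id) => //.
  by apply/matrixP=> i j; rewrite !mxE /f /f' cast_ordKV.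
apply: meqv_trans AE _.
(* The first m rows of the pencil annihilate the column (1, X, ..., X^m) and the last row gives p.
   So this [x] solves the equation in [meqv_schur], with Schur complement p. *)
pose x : 'M[{poly F}]_(m, 1) := \matrix_(i, j) 'X^(i.+1).
have Ax : mxsub f id A *m col_mx 1%:M x = col_mx 0 p%:M.
  have -> : col_mx 1%:M x = \matrix_(i < 1 + m, j < 1) 'X^(i).
    apply/matrixP=> i j; rewrite ord1 !mxE; case: (split_ordP i) => i' ->.
      by rewrite ord1 !mxE /= expr0.
    by rewrite !mxE.
  apply/matrixP=> i j; rewrite ord1 !mxE.
  under eq_bigr => l _ do rewrite !mxE mulrBl.
  rewrite big_split /= (bigD1 (f i)) //= big1 ?addr0 => [|l lf]; last first.
    by rewrite -(inj_eq val_inj) /= in lf; rewrite eq_sym (negPf lf) mul0r.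
  rewrite eqxx -exprS sumrN.
  case: (split_ordP i) => i' ->; rewrite !mxE.
    rewrite (bigD1 (lift ord0 i')) //= big1 ?addr0 => [|l lf]; last first.
      rewrite -(inj_eq val_inj) /= in lf.
      by rewrite ltn_eqF // eq_sym (negPf lf) mul0r.
    by rewrite ltn_eqF // eqxx mul1r subrr.
  rewrite ord1 /= addn0 !eqxx mulr1n -[RHS]coefK sp poly_def [RHS]big_ord_recr /=.
  have := monicP pm; rewrite /lead_coef sp /= => ->; rewrite scale1r addrC; congr (_ + _).
  rewrite -sumrN; apply: eq_bigr => l _.
  by rewrite polyCN mulNr opprK mul_polyC.
rewrite -[mxsub f id A]submxK in Ax *.
move: Ax; rewrite mul_block_col !mulmx1 => /eq_col_mx [Eu Ep].
(* Without its first column and last row the pencil is lower triangular with -1 on the diagonal. *)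
have Lu : ursubmx (mxsub f id A) \in unitmx.
  rewrite unitmxE det_trig.
    apply: rpred_prod => i _; rewrite !mxE /= ltn_eqF // eqxx.
    by rewrite ltn_eqF ?rpredB ?unitrN // sub0r unitrN unitr1.
  apply/is_trig_mxP => i j ij; rewrite !mxE /=.
  by rewrite !ltn_eqF ?subr0 // ltnW // ltnS.
apply: meqv_trans (meqv_schur _ _ Lu Eu) _; rewrite Ep.
apply: meqv_trans (meqv_blockC _ _) _.
apply: meqv_trans (meqv_diag_cat _ _).
by apply: meqv_block; [apply: meqv_1_diag|apply: meqv_scalar_diag].
Qed.

End Companion.
End Krylov.

(** * Invariant complements of cyclic subspaces *)

Section Splitting.
Variable F : finFieldType.
Implicit Types (g h p : {poly F}) (d m : nat).

Definition cokrylov m d (u : 'cV[F]_d) (C : 'M[F]_d) : 'M[F]_(d, m.+1) :=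
  (krylov m u^T C^T)^T.

(* [v C^i u] is 1 for [i = m] and 0 for [i < m]: a vector with the functional whose Krylov
   kernel is an invariant complement of the cyclic space of [v]. *)
Definition dual_pair m d (C : 'M[F]_d) (v : 'rV[F]_d) (u : 'cV[F]_d) : bool :=
  krylov m v C *m u == delta_mx ord_max 0.

Lemma expmx_tr d (C : 'M[F]_d) n : (C ^+ n)^T = C^T ^+ n.
Proof.
elim: n => [|n IH]; first by rewrite !expr0 -!idmxE trmx1.
by rewrite exprS exprSr -!mulmxE trmx_mul IH.
Qed.

Lemma mx_eval_tr d (C : 'M[F]_d) g : (mx_eval C g)^T = mx_eval C^T g.
Proof.
by rewrite /mx_eval raddf_sum; apply: eq_bigr => i _; rewrite /= linearZ /= expmx_tr.
Qed.

Lemma col_cokrylov m d (u : 'cV[F]_d) (C : 'M[F]_d) j :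
  col j (cokrylov m u C) = C ^+ j *m u.
Proof. by rewrite -tr_row rowK trmx_mul trmxK expmx_tr trmxK. Qed.

Lemma cokrylov_compan m d (u : 'cV[F]_d) (C : 'M[F]_d) p :
  p \is monic -> size p = m.+2 -> mx_eval C p = 0 ->
  C *m cokrylov m u C = cokrylov m u C *m (compan m p)^T.
Proof.
move=> pm sp Cp; apply: trmx_inj; rewrite !trmx_mul !trmxK.
by apply: krylov_compan => //; rewrite -mx_eval_tr Cp trmx0 mulmx0.
Qed.

(* The entries [v C^(i+j) u] vanish for [i + j < m] and are 1 for [i + j = m]. *)
Lemma dual_pair_unit m d (C : 'M[F]_d) v u :
  dual_pair m C v u -> krylov m v C *m cokrylov m u C \in unitmx.
Proof.
move=> /eqP Kdu; set T := _ *m _.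
have mxrc n n1 n2 (A : 'M[F]_(n1, n)) (B : 'M_(n, n2)) i j :
    (A *m B) i j = (row i A *m col j B) 0 0.
  by rewrite !mxE; apply: eq_bigr => l _; rewrite !mxE.
have vu n : (n <= m)%N -> (v *m C ^+ n *m u) 0 0 = (n == m)%:R.
  move=> nm; have E := congr1 (fun A : 'M_(_, _) => A (Ordinal (nm : n < m.+1)%N) 0) Kdu.
  by rewrite mxrc rowK col_id [RHS]mxE eqxx andbT in E; rewrite E.
have TE i j : T i j = (v *m C ^+ (i + j) *m u) 0 0.
  by rewrite [LHS]mxrc rowK col_cokrylov mulmxA -[v *m _ *m _]mulmxA mulmxE -exprD.
pose s : 'S_m.+1 := perm (@rev_ord_inj m.+1).
suff : col_perm s T \in unitmx by rewrite col_permE unitmx_mul unitmx_perm andbT.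
rewrite unitmxE det_trig.
  apply: rpred_prod => i _; rewrite mxE TE permE /= subSS.
  by rewrite subnKC ?vu ?eqxx ?unitr1 // -ltnS.
apply/is_trig_mxP => i j ij; rewrite mxE TE permE /= subSS.
have E : (i + (m - j) < m)%N by have := ltn_ord j; lia.
by rewrite vu ?ltn_eqF // ltnW.
Qed.

(** The kernel of [cokrylov m u C] is stable, because C acts on the columns through the transposed
    companion matrix. It meets the cyclic space only in 0, because the product of the Krylov and
    cokrylov matrices is invertible. *)
Lemma dual_pair_split m d' (C : 'M[F]_(m.+1 + d')) v u p (Q2 : 'M_(d', m.+1 + d')) :
  p \is monic -> size p = m.+2 -> mx_eval C p = 0 -> dual_pair m C v u ->
  row_free Q2 -> Q2 *m cokrylov m u C = 0 ->
  let Q := col_mx (krylov m v C) Q2 in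
  Q \in unitmx /\ exists C', Q *m C = block_mx (compan m p) 0 0 C' *m Q.
Proof.
move=> pm sp Cp vu Q2f Q2L Q; have KLu := dual_pair_unit vu.
set K := krylov m v C in Q KLu *; set L := cokrylov m u C in Q2L KLu *.
split.
  rewrite -row_free_unit -kermx_eq0; apply/rowV0P => a /sub_kermxP.
  rewrite -[a]hsubmxK /Q mul_row_col; set a1 := lsubmx a; set a2 := rsubmx a => E.
  have a10 : a1 = 0.
    move: (congr1 (mulmx^~ L) E); rewrite mulmxDl mul0mx -!mulmxA Q2L mulmx0 addr0.
    by move/(congr1 (mulmx^~ (invmx (K *m L)))); rewrite mulmxK // mul0mx.
  move: E; rewrite a10 mul0mx add0r => /(congr1 (mulmx^~ (pinvmx Q2))).
  by rewrite mul0mx -mulmxA mulmxVp // mulmx1 => ->; rewrite row_mx0.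
have Lfree : \rank L = m.+1.
  apply/eqP; rewrite eqn_leq rank_leq_col -{1}(mxrank_unit KLu); exact: mxrankM_maxr.
have Q2E : (Q2 :=: kermx L)%MS.
  apply/eqmxP; rewrite -(geq_leqif (mxrank_leqif_eq _)); last exact/sub_kermxP.
  by rewrite mxrank_ker Lfree addKn (eqP Q2f).
have /submxP[C' EC] : (Q2 *m C <= Q2)%MS.
  rewrite Q2E; apply/sub_kermxP; rewrite -mulmxA (cokrylov_compan _ pm sp Cp) mulmxA.
  by rewrite Q2L mul0mx.
exists C'; rewrite mul_col_mx mul_block_col !mul0mx addr0 add0r EC.
by rewrite (krylov_compan pm sp) // Cp mulmx0.
Qed.

Lemma ann_krylov_free m d (C : 'M[F]_d) (v : 'rV_d) p : size p = m.+2 ->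
  (forall g, v *m mx_eval C g = 0 -> p %| g) -> row_free (krylov m v C).
Proof.
move=> sp Hv; rewrite -kermx_eq0; apply/rowV0P => a /sub_kermxP.
rewrite mul_krylov => /Hv pa; apply: (can_inj (@rVpolyK _ _)); rewrite linear0.
apply/eqP; apply: contraT => a0; have := dvdp_leq a0 pa.
by rewrite leqNgt sp ltnS size_poly.
Qed.

(** A dual functional forces the Krylov rows to be independent, so the remainder of g modulo p
    vanishes. Thus dual pairs exist only over vectors whose annihilator is generated by p. *)
Lemma dual_pair_ann m d (C : 'M[F]_d) (v : 'rV_d) u p : p \is monic -> size p = m.+2 ->
  mx_eval C p = 0 -> dual_pair m C v u -> forall g, v *m mx_eval C g = 0 -> p %| g.
Proof.
move=> pm sp Cp vu g; have p0 := monic_neq0 pm.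
have Kf : row_free (krylov m v C).
  apply/row_freeP; exists (cokrylov m u C *m invmx (krylov m v C *m cokrylov m u C)).
  by rewrite mulmxA mulmxV // dual_pair_unit.
rewrite {1}(divp_eq g p) mx_evalD mx_evalM Cp mulmx0 add0r.
have sz : (size (g %% p)%R <= m.+1)%N by rewrite -ltnS -sp ltn_modp.
rewrite -(poly_rV_K sz) -mul_krylov => /(congr1 (mulmx^~ (pinvmx (krylov m v C)))).
rewrite mul0mx -mulmxA mulmxVp // mulmx1 => E.
by rewrite /dvdp -(poly_rV_K sz) E linear0.
Qed.

Lemma ex_dual_pair m d (C : 'M[F]_d) (v : 'rV_d) : row_free (krylov m v C) ->
  exists u, dual_pair m C v u.
Proof.
by move=> /row_freeP[B KB]; exists (B *m delta_mx ord_max 0); rewrite /dual_pair mulmxA KB mul1mx.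
Qed.

Lemma ex_ker_cokrylov m d' (C : 'M[F]_(m.+1 + d')) v u : dual_pair m C v u ->
  exists Q2 : 'M_(d', m.+1 + d'), row_free Q2 /\ (Q2 :=: kermx (cokrylov m u C))%MS.
Proof.
move=> vu; set L := cokrylov m u C.
have rk : \rank (kermx L) = d'.
  rewrite mxrank_ker (_ : \rank L = m.+1) ?addKn //.
  apply/eqP; rewrite eqn_leq rank_leq_col -{1}(mxrank_unit (dual_pair_unit vu)).
  exact: mxrankM_maxr.
move: (row_base_free (kermx L)) (eq_row_base (kermx L)); move: (row_base _).
by rewrite rk => Q2 Q2f Q2E; exists Q2.
Qed.

End Splitting.

(** * Invariant factors of square matrices *)

Section Structure.
Variable F : finFieldType.
Implicit Types (g h p : {poly F}) (s t : seq {poly F}) (d m : nat).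

Definition degsum s := (\sum_(t <- s) (size t).-1)%N.

(** One induction along cyclic summands yields these properties together. The kernel sizes feed the
    count of vectors of maximal order; the last clause makes the largest factor the minimal
    polynomial, with default 1 for d = 0. *)
Definition smith_type d (C : 'M[F]_d) s : Prop :=
  [/\ [/\ size s = d, chain s & degsum s = d], meqv (xImB C) (diag_of s),
      (forall g, ker_card C g = #|F| ^ \sum_(t <- s) (size (gcdp g t)).-1)%N
    & forall g, mx_eval C g = 0 <-> last 1 s %| g].

Lemma ker_card_conj d (C C1 Q : 'M[F]_d) g : Q \in unitmx -> Q *m C = C1 *m Q ->
  ker_card C g = ker_card C1 g.
Proof.
move=> Qu QC; have E := mx_eval_comm g QC.
rewrite /ker_card -[RHS](card_imset _ (f := mulmx^~ Q)); last first.
  by move=> x y /(congr1 (mulmx^~ (invmx Q))); rewrite !mulmxK.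
apply: eq_card => v; rewrite inE; apply/idP/imsetP => [vC|[w]].
  exists (v *m invmx Q); last by rewrite mulmxKV.
  have : v *m invmx Q *m (mx_eval C1 g *m Q) = 0 by rewrite -E !mulmxA mulmxKV // (eqP vC).
  by rewrite inE mulmxA => /(congr1 (mulmx^~ (invmx Q))); rewrite mulmxK // mul0mx => ->.
by rewrite inE => /eqP wC ->; rewrite -mulmxA E mulmxA wC mul0mx.
Qed.

Lemma smith_type_conj d (C C1 Q : 'M[F]_d) s : Q \in unitmx -> Q *m C = C1 *m Q ->
  smith_type C1 s -> smith_type C s.
Proof.
move=> Qu QC [H1 H2 H3 H4]; split=> // [|g|g].
- exact: meqv_trans (xImB_conj Qu QC) H2.
- by rewrite (ker_card_conj g Qu QC).
rewrite -H4; have E := mx_eval_comm g QC; split=> H.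
  by rewrite -[mx_eval C1 g](mulmxK Qu) -E H mulmx0 mul0mx.
by rewrite -[mx_eval C g](mulKmx Qu) E H mul0mx mulmx0.
Qed.

Lemma ker_card_block d d' (C : 'M[F]_d) (D : 'M_d') g :
  ker_card (block_mx C 0 0 D) g = (ker_card C g * ker_card D g)%N.
Proof.
rewrite /ker_card -cardsX -[RHS](card_imset _ (f := fun w => row_mx w.1 w.2)); last first.
  by move=> [x y] [x' y'] /= /eq_row_mx[-> ->].
apply: eq_card => v; rewrite inE mx_eval_block; apply/idP/imsetP => [|[[x y]]].
  rewrite -{1}[v]hsubmxK mul_row_block !mulmx0 addr0 add0r => /eqP H.
  exists (lsubmx v, rsubmx v); rewrite /= ?hsubmxK // !inE /=.
  by move: H; rewrite -[RHS]row_mx0 => /eq_row_mx[-> ->]; rewrite !eqxx.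
rewrite !inE /= => /andP[/eqP xC /eqP yD] ->.
by rewrite mul_row_block !mulmx0 addr0 add0r xC yD row_mx0.
Qed.

Lemma chain_extend m s p : p \is monic -> chain s -> last 1 s %| p ->
  chain (nseq m 1 ++ rcons s p).
Proof.
move=> pm [smon sdvd] lp.
have mon i : (i < size (rcons s p))%N -> (rcons s p)`_i \is monic.
  rewrite size_rcons ltnS leq_eqVlt nth_rcons => /orP[/eqP->|si].
    by rewrite ltnn eqxx.
  by rewrite si smon.
split=> [i|i j /andP[ij]]; rewrite size_cat size_nseq !nth_cat size_nseq !nth_nseq.
  by case: (ltnP i m) => im /=; [rewrite monic1|move=> H; apply: mon; lia].
have [im|im] := ltnP i m; first by rewrite dvd1p.
rewrite (ltnNge j m) (leq_trans im ij) /= size_rcons => H.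
rewrite !nth_rcons; have [js|js] := ltnP (j - m) (size s).
  have -> : (i - m < size s)%N by lia.
  by apply: sdvd; lia.
have -> : (j - m == size s)%N by apply/eqP; lia.
have [is_|is_] := ltnP (i - m) (size s).
  rewrite (last_nth 0) in lp; case: (s) is_ js sdvd lp => //= a s' is_ js sdvd lp.
  by apply: dvdp_trans lp; apply: (sdvd _ (size s')); lia.
have -> : (i - m == size s)%N by apply/eqP; lia.
exact: dvdpp.
Qed.

Lemma degsum_cat s t : degsum (s ++ t) = (degsum s + degsum t)%N.
Proof. by rewrite /degsum big_cat. Qed.

Lemma degsum_nseq1 m : degsum (nseq m (1 : {poly F})) = 0%N.
Proof. by rewrite /degsum big1_seq // => t; rewrite mem_nseq => /andP[_ /andP[_ /eqP ->]]; rewrite size_poly1. Qed.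

Lemma degsum_rcons s p : degsum (rcons s p) = (degsum s + (size p).-1)%N.
Proof. by rewrite -cats1 degsum_cat /degsum big_seq1. Qed.

(** The companion block contributes m ones and p. The ones go to the front and p to the end, where
    it extends the chain because it is a multiple of the last entry of [s]. *)
Lemma smith_type_extend m d (C : 'M[F]_d) s p : p \is monic -> size p = m.+2 ->
  smith_type C s -> last 1 s %| p ->
  smith_type (block_mx (compan m p) 0 0 C) (nseq m 1 ++ rcons s p).
Proof.
move=> pm sp [[ss sch sd] H2 H3 H4] lp; split.
- split; [|exact: chain_extend|].
    by rewrite size_cat size_nseq size_rcons ss addnS addSn.
  by rewrite degsum_cat degsum_nseq1 degsum_rcons sd sp add0n addnC.
- rewrite xImB_block; apply: meqv_trans (meqv_block (meqv_compan pm sp) H2) _.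
  apply: meqv_trans (meqv_diag_cat _ _) _; rewrite -catA -cats1.
  apply: meqv_trans (meqv_sym (meqv_diag_cat _ _)) _.
  apply: meqv_trans (meqv_diag_cat _ _); apply: meqv_block; first exact: meqv_refl.
  apply: meqv_trans (meqv_sym (meqv_diag_cat _ _)) _.
  by apply: meqv_trans (meqv_diag_cat _ _); apply: meqv_blockC.
- move=> g; rewrite ker_card_block (ker_card_compan pm sp) H3 -expnD; congr (_ ^ _)%N.
  rewrite big_cat -cats1 big_cat big_seq1 /= [X in _ = (X + _)%N]big1_seq.
    by rewrite add0n addnC.
  by move=> t; rewrite mem_nseq => /andP[_ /andP[_ /eqP ->]]; rewrite (eqp_size (gcdp1 g)) size_poly1.
move=> g; rewrite last_cat last_rcons mx_eval_block; split=> [|pg].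
  by rewrite -[0 in RHS]block_mx0 => /eq_block_mx[/(compan_eval0 pm sp)].
rewrite (compan_eval0 pm sp g).2 // (H4 g).2 ?block_mx0 //.
exact: dvdp_trans pg.
Qed.

(** A vector realising the minimal polynomial p spans a summand with an invariant complement. As p
    kills the complement too, the last factor found there by induction divides p. *)
Lemma ex_smith_type d (C : 'M[F]_d) : exists s, smith_type C s.
Proof.
have [n] := ubnP d; elim: n d C => // n IH d C dn.
have [p [pm Cp] pmin] := ex_mx_minpoly C.
have [d0|d_gt0] := posnP d; first subst d.
  exists [::]; split; rewrite ?/degsum ?big_nil //.
  - by split=> //; split=> [i|i j] //; rewrite andbF.
  - by split; exists 0, 0; rewrite [LHS]flatmx0 [RHS]flatmx0.
  - move=> g; rewrite big_nil expn0 /ker_card -[RHS](card_mx F 1 0).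
    by apply: eq_card => v; rewrite !inE [X in X == _]thinmx0 eqxx.
  by move=> g; split=> _; rewrite ?dvd1p // [LHS]flatmx0.
have p1 : (1 < size p)%N.
  rewrite ltn_neqAle eq_sym size_poly_gt0 monic_neq0 // andbT; apply/negP => /eqP sp.
  have p_1 : p = 1 by apply/eqP; rewrite -eqp_monic ?monic1 // -size_poly_eq1 sp.
  by move: Cp; rewrite p_1 mx_eval1; case: (d) d_gt0 => // d1 _ /eqP; rewrite oner_eq0.
case sp : (size p) p1 => [|[|m]] // _.
have [v vp] := ex_ann_vector (monic_neq0 pm) Cp pmin.
have Kf := ann_krylov_free sp vp.
have md : (m.+1 <= d)%N by rewrite -(eqP Kf) rank_leq_col.
have [d' E] : exists d', d = (m.+1 + d')%N by exists (d - m.+1)%N; rewrite subnKC.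
subst d; have [u vu] := ex_dual_pair Kf.
have [Q2 [Q2f Q2E]] := ex_ker_cokrylov vu.
have /sub_kermxP Q2L : (Q2 <= kermx (cokrylov m u C))%MS by rewrite Q2E.
have [Qu [C' QC]] := dual_pair_split pm sp Cp vu Q2f Q2L.
have [|s Hs] := IH _ C'; first by move: dn; clear; lia.
exists (nseq m 1 ++ rcons s p); apply: (smith_type_conj Qu QC).
apply: smith_type_extend => //; have [_ _ _ H4] := Hs; apply/H4 => {H4}.
have E := mx_eval_comm p QC; move: E; rewrite Cp mulmx0 => /esym/(congr1 (mulmx^~ (invmx (col_mx (krylov m v C) Q2)))).
rewrite mulmxK // mul0mx mx_eval_block -[0 in RHS]block_mx0.
by case/eq_block_mx.
Qed.

(** [invs] is a function of the matrix, so every diagonal form found for it is the same one;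
    existence then gives [invs] all properties of [smith_type]. *)
Lemma smith_typeE d (C : 'M[F]_d) s : smith_type C s <-> s = invs C.
Proof.
have H t : smith_type C t -> t = invs C.
  by case=> [[ts tch _] tE _ _]; rewrite (invs_meqv tch).
split=> [/H //|->]; have [t Ht] := ex_smith_type C.
by rewrite -(H t).
Qed.

Lemma smith_type_invs d (C : 'M[F]_d) : smith_type C (invs C).
Proof. exact/smith_typeE. Qed.

End Structure.

(** * Splitting off a cyclic summand *)

Section ClassCount.
Variable F : finFieldType.
Implicit Types (g h p : {poly F}) (s t : seq {poly F}) (d m : nat).
Local Notation q := #|F|.

Lemma col_mulmx n1 n2 n3 (A : 'M[F]_(n1, n2)) (B : 'M_(n2, n3)) j :
  col j (A *m B) = A *m col j B.
Proof. by rewrite !colE mulmxA. Qed.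

Lemma card_row_bases r n (Q : 'M[F]_(r, n)) : row_free Q ->
  #|[set Q2 : 'M[F]_(r, n) | row_free Q2 && (Q2 <= Q)%MS]| = glcard F r.
Proof.
move=> Qf; have inj : injective (mulmx^~ Q : 'M_(r, r) -> _) by apply: row_free_inj.
rewrite /glcard -(card_imset _ inj); apply: eq_card => Q2; rewrite inE.
apply/andP/imsetP => [[Q2f /submxP[Y E]]|[Y]].
  exists Y => //; rewrite inE -row_free_unit; apply/eqP/eqP; rewrite eqn_leq rank_leq_row.
  by rewrite -{1}(eqP Q2f) E mxrankM_maxl.
rewrite inE => Yu ->; split; last exact: submxMl.
by rewrite /row_free mxrankMfree // mxrank_unit.
Qed.

(** The fibres of a surjective linear map are translates of one another, so q^m of them share the
    q^(m+d) vectors equally. *)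
Lemma card_affine m d (K : 'M[F]_(m, m + d)) (b : 'cV_m) : row_free K ->
  #|[set u : 'cV_(m + d) | K *m u == b]| = (q ^ d)%N.
Proof.
move=> /row_freeP[B KB].
have E b' : #|[set u : 'cV_(m + d) | K *m u == b']| = #|[set u : 'cV_(m + d) | K *m u == b]|.
  rewrite -(card_imset _ (addrI (B *m (b - b')))); apply: eq_card => u; rewrite inE.
  apply/imsetP/eqP => [[w] /[!inE] /eqP wb ->|ub].
    by rewrite mulmxDr mulmxA KB mul1mx wb subrK.
  exists (u - B *m (b - b')); last by rewrite addrC subrK.
  by rewrite inE mulmxBr mulmxA KB mul1mx ub subKr.
have q0 : (0 < q ^ m)%N by rewrite expn_gt0; apply/orP; left; apply/card_gt0P; exists 0.
have cm r : #|{: 'cV[F]_r}| = (q ^ r)%N by rewrite card_mx muln1.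
apply/eqP; rewrite -(eqn_pmul2l q0) -expnD -!cm -sum_nat_const -[X in _ == X]sum1_card.
rewrite [X in _ == X](partition_big (mulmx K) predT) //; apply/eqP.
by apply: eq_bigr => b' _; rewrite -(E b') -sum1_card; apply: eq_bigl => u; rewrite inE.
Qed.

(** If p(C) = 0 with p monic of degree m + 1, these are the vectors whose annihilator is generated
    by p. *)
Definition cyc_vectors m d (C : 'M[F]_d) : {set 'rV[F]_d} :=
  [set v | row_free (krylov m v C)].

Definition type_class d s : {set 'M[F]_d} := [set C | invs C == s].

Section Step.
Variables (m d : nat) (p : {poly F}) (s : seq {poly F}).
Hypotheses (pm : p \is monic) (sp : size p = m.+2) (lp : last 1 s %| p).
Let t := nseq m 1 ++ rcons s p.
Local Notation n := (m.+1 + d)%N.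

Lemma class_eval0 (C : 'M[F]_n) : invs C = t -> mx_eval C p = 0.
Proof. by case/esym/smith_typeE=> _ _ _ H4; apply/H4; rewrite last_cat last_rcons. Qed.

(** [smith_type_extend] computes the factors of the block matrix from those of [C]; dropping the m
    ones and the last entry recovers the latter. *)
Lemma class_blockP (C : 'M[F]_d) :
  invs (block_mx (compan m p) 0 0 C) = t <-> invs C = s.
Proof.
split=> [/[dup] CE /class_eval0|CE].
  rewrite mx_eval_block -[0 in RHS]block_mx0 => /eq_block_mx[_ _ _ Cp].
  have Cs := smith_type_invs C; have [_ _ _ /(_ p) [H4 _]] := Cs.
  have := smith_type_extend pm sp Cs (H4 Cp) => /smith_typeE; rewrite CE.
  by move=> /(congr1 (drop m)); rewrite !drop_size_cat ?size_nseq // => /rcons_inj[].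
symmetry; apply/smith_typeE; apply: smith_type_extend => //.
by apply/smith_typeE.
Qed.

Lemma invs_conj d' (C C1 Q : 'M[F]_d') : Q \in unitmx -> Q *m C = C1 *m Q -> invs C = invs C1.
Proof.
by move=> Qu QC; symmetry; apply/smith_typeE/(smith_type_conj Qu QC)/smith_type_invs.
Qed.

Definition split_bases (C : 'M[F]_n) : {set 'M[F]_n} :=
  [set Q | (Q \in unitmx) &&
     (Q *m C *m invmx Q == block_mx (compan m p) 0 0 (drsubmx (Q *m C *m invmx Q)))].

Lemma split_basesP (C Q : 'M[F]_n) :
  reflect (Q \in unitmx /\ exists C', Q *m C = block_mx (compan m p) 0 0 C' *m Q)
          (Q \in split_bases C).
Proof.
rewrite inE; apply: (iffP andP) => -[Qu].
  by move=> /eqP E; split=> //; exists (drsubmx (Q *m C *m invmx Q)); rewrite -E mulmxKV.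
by case=> C' ->; rewrite mulmxK // block_mxKdr eqxx.
Qed.

(** A splitting basis amounts to a vector v, a functional u dual to it, and a basis of the kernel of
    the cokrylov matrix of u. For given v the u form an affine space with q^d points; for given u
    there are |GL_d| bases. *)
Lemma card_split_bases (C : 'M[F]_n) : mx_eval C p = 0 ->
  #|split_bases C| = (#|cyc_vectors m C| * q ^ d * glcard F d)%N.
Proof.
move=> Cp.
pose W := [set w : 'rV[F]_n * 'cV[F]_n * 'M[F]_(d, n) |
  [&& dual_pair m C w.1.1 w.1.2, row_free w.2 & w.2 *m cokrylov m w.1.2 C == 0]].
pose f (w : 'rV[F]_n * 'cV[F]_n * 'M[F]_(d, n)) := col_mx (krylov m w.1.1 C) w.2.
have finj : {in W &, injective f}.
  move=> [[v u] Q2] [[v' u'] Q2']; rewrite !inE /= => /and3P[vu Q2f /eqP Q2L].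
  move=> /and3P[vu' Q2f' /eqP Q2L']; rewrite /f /= => /eq_col_mx[KE QE].
  have vE : v = v'.
    by have := congr1 (row 0) KE; rewrite !rowK expr0 !mulmx1.
  congr (_, _, _) => //.
  have [Qu _] := dual_pair_split pm sp Cp vu Q2f Q2L.
  (* The first column of the cokrylov matrix is u itself; hence Q u = (e_m, 0), and Q determines
     u. *)
  have Q2u x : Q2 *m cokrylov m x C = 0 -> Q2 *m x = 0.
    move=> H; have := col_cokrylov x C (ord0 : 'I_m.+1); rewrite expr0 mul1mx => <-.
    by rewrite -col_mulmx H linear0.
  apply: (can_inj (mulKmx Qu)); rewrite !mul_col_mx (eqP vu) KE (eqP vu') Q2u //.
  by rewrite Q2u // QE.
have -> : split_bases C = f @: W.
  apply/setP=> Q; apply/split_basesP/imsetP => [[Qu [C' QC]]|].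
    have QQ := mulmxV Qu.
    pose K := usubmx Q; pose Q2 := dsubmx Q.
    have [KC Q2C] : K *m C = compan m p *m K /\ Q2 *m C = C' *m Q2.
      have E : block_mx (compan m p) 0 0 C' *m Q = col_mx (compan m p *m K) (C' *m Q2).
        by rewrite -{1}[Q]vsubmxK mul_block_col !mul0mx addr0 add0r.
      by rewrite /K /Q2 mul_usub_mx mul_dsub_mx QC E col_mxKu col_mxKd.
    have powC k r (A : 'M[F]_(r, n)) c : A *m C = c *m A -> A *m C ^+ k = c ^+ k *m A.
      by move=> /(mx_eval_comm 'X^k); rewrite !mx_evalXn.
    have KE : K = krylov m (row 0 K) C.
      apply/row_matrixP=> i; rewrite rowK [row 0 K]rowE -mulmxA (powC _ _ _ _ KC) mulmxA.
      by rewrite (delta_compan _ (ltn_ord i)) rowE.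
    (* Column m of the inverse of Q: it takes the value 1 on the last Krylov row and 0 on all other
       rows of Q. *)
    pose u : 'cV_n := invmx Q *m col_mx (delta_mx ord_max 0) 0.
    have Q2u : Q2 *m u = 0 by rewrite mul_dsub_mx mulKVmx // col_mxKd.
    exists (row 0 K, u, Q2); last by rewrite /f /= -KE vsubmxK.
    rewrite inE /=; apply/and3P; split.
    - by rewrite /dual_pair -KE mul_usub_mx mulKVmx // col_mxKu.
    - apply/row_freeP; exists (rsubmx (invmx Q)).
      by rewrite mulmx_rsub mul_dsub_mx QQ scalar_mx_block /block_mx col_mxKd row_mxKr.
    apply/eqP/trmx_inj/row_matrixP=> j; rewrite -!tr_col [in RHS]linear0 col_mulmx col_cokrylov mulmxA.
    by rewrite (powC _ _ _ _ Q2C) -mulmxA Q2u mulmx0.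
  case=> -[[v u] Q2]; rewrite inE /= => /and3P[vu Q2f /eqP Q2L] ->.
  by apply: dual_pair_split vu _ _.
rewrite card_in_imset // -sum1_card.
transitivity (\sum_(w : 'rV[F]_n * 'cV[F]_n | dual_pair m C w.1 w.2)
    \sum_(Q2 : 'M[F]_(d, n) | row_free Q2 && (Q2 *m cokrylov m w.2 C == 0)%R) 1)%N.
  by rewrite pair_big_dep /=; apply: eq_bigl => w; rewrite inE.
transitivity (\sum_(w : 'rV[F]_n * 'cV[F]_n | dual_pair m C w.1 w.2) glcard F d)%N.
  apply: eq_bigr => -[v u] /= vu; have [Q20 [Q20f Q20E]] := ex_ker_cokrylov vu.
  rewrite -(card_row_bases Q20f) -sum1_card; apply: eq_bigl => Q2; rewrite inE.
  by rewrite Q20E sub_kermx.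
rewrite sum_nat_const; congr (_ * _)%N; rewrite -sum1_card.
transitivity (\sum_(v in cyc_vectors m C) \sum_(u : 'cV[F]_n | dual_pair m C v u) 1)%N.
  rewrite pair_big_dep /=; apply: eq_bigl => -[v u] /=.
  rewrite !inE; apply/idP/andP=> [vu|[]//]; split=> //.
  exact/(ann_krylov_free sp)/(dual_pair_ann pm sp Cp vu).
rewrite -sum_nat_const; apply: eq_bigr => v; rewrite inE => vf.
rewrite -(card_affine (delta_mx ord_max 0) vf) -sum1_card.
by apply: eq_bigl => u; rewrite inE.
Qed.

(** Both sides count pairs (Q, C) with Q a splitting basis of C: on the left Q and the complementary
    block are chosen freely, on the right C comes first. *)
Lemma class_count_step :
  (glcard F n * #|type_class d s| =
   (\sum_(C in type_class n t) #|cyc_vectors m C|) * q ^ d * glcard F d)%N.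
Proof.
pose f (w : 'M[F]_n * 'M[F]_d) :=
  (w.1, invmx w.1 *m block_mx (compan m p) 0 0 w.2 *m w.1).
pose Z := [set z : 'M[F]_n * 'M[F]_n | (z.2 \in type_class n t) && (z.1 \in split_bases z.2)].
transitivity #|Z|.
  rewrite -cardsX -(card_in_imset (f := f)).
    apply: eq_card => -[Q C]; apply/imsetP/idP => [[[Q' C']]|].
      rewrite !inE /= => /andP[Qu /eqP Cs] [-> ->] /=.
      have E : Q' *m (invmx Q' *m block_mx (compan m p) 0 0 C' *m Q') =
        block_mx (compan m p) 0 0 C' *m Q' by rewrite !mulmxA mulmxV // mul1mx.
      rewrite E mulmxK // block_mxKdr Qu !eqxx !andbT; apply/eqP.
      by rewrite (invs_conj Qu E); apply/class_blockP.
    rewrite !inE /= => /andP[/eqP Ct /andP[Qu /eqP E]].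
    have QC : Q *m C = block_mx (compan m p) 0 0 (drsubmx (Q *m C *m invmx Q)) *m Q.
      by rewrite -E mulmxKV.
    exists (Q, drsubmx (Q *m C *m invmx Q)); last first.
      by rewrite /f /= -mulmxA -QC mulKmx.
    rewrite !inE /= Qu; apply/eqP/class_blockP.
    by rewrite -(invs_conj Qu QC).
  move=> [Q C] [Q' C']; rewrite !inE /= => /andP[Qu _] _ [<- E]; congr (_, _).
  move: E => /(congr1 (fun A => Q *m A *m invmx Q)).
  by rewrite !mulmxA mulmxV // !mul1mx !mulmxK // => /eq_block_mx[].
rewrite -sum1_card !big_distrl /=.
transitivity (\sum_(C in type_class n t) \sum_(Q in split_bases C) 1)%N.
  have si : injective (fun w : 'M[F]_n * 'M[F]_n => (w.2, w.1)) by move=> [a b] [a' b'] [-> ->].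
  rewrite pair_big_dep /= (reindex_inj si) //=.
  by apply: eq_bigl => -[C Q]; rewrite inE.
apply: eq_bigr => C; rewrite inE => /eqP Ct.
by rewrite sum1_card card_split_bases // class_eval0.
Qed.

End Step.
End ClassCount.

(** * Vectors of maximal order *)

Section CyclicVectors.
Variable F : finFieldType.
Implicit Types (f g h p t : {poly F}) (s T S : seq {poly F}) (d m : nat).
Local Notation q := #|F|.

Lemma size_mul_pred f g : f != 0 -> g != 0 ->
  (size (f * g)).-1 = ((size f).-1 + (size g).-1)%N.
Proof.
move=> f0 g0; rewrite size_mul //; move: f0 g0; rewrite -!size_poly_gt0.
by move: (size (polyseq f)) (size (polyseq g)) => a b; lia.
Qed.

(** The last hypothesis says that g contains the full power of f in p. Cancelling f from g then
    shrinks the gcd with t precisely when t contains this full power too. The quotient of the two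
    gcds divides f, so it is a unit or f up to a unit. *)
Lemma size_gcd_div_irred f g t p : p != 0 -> irreducible_poly f -> g %| p -> t %| p -> f %| g ->
  ~~ (f %| p %/ g) ->
  (size (gcdp g t)).-1 = ((size (gcdp (g %/ f)%R t)).-1 + (size f).-1 * ~~ (t %| p %/ f)%R)%N.
Proof.
move=> p0 fi /dvdpP[k pE] tp /dvdpP[g1 gE]; subst g.
have f0 : f != 0 by case: fi => f1 _; rewrite -size_poly_gt0 ltnW.
have g10 : g1 != 0 by apply: contraNneq p0 => z; rewrite pE z mul0r mulr0.
have k0 : k != 0 by apply: contraNneq p0 => z; rewrite pE z mul0r.
rewrite pE mulpK ?mulf_neq0 // => fk.
have -> : k * (g1 * f) %/ f = k * g1 by rewrite mulrA mulpK.
rewrite mulpK //.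
have cfk : coprimep f k by rewrite irred_coprimep.
set D := gcdp (g1 * f) t; set D' := gcdp g1 t.
have t0 : t != 0 by apply: dvdpN0 tp p0.
have D'0 : D' != 0 by rewrite gcdp_eq0 negb_and g10.
have DD' : D' %| D by rewrite dvdp_gcd dvdp_gcdr andbT dvdp_mulr // dvdp_gcdl.
have DfD : D %| D' * f.
  rewrite (eqp_dvdr _ (mulp_gcdl _ _ _)) dvdp_gcd dvdp_gcdl /=.
  by rewrite dvdp_mulr // dvdp_gcdr.
have [tk|tk] := boolP (t %| k * g1); rewrite ?muln0 ?muln1 ?addn0.
  congr _.-1; apply: eqp_size; rewrite /eqp DD' andbT dvdp_gcd dvdp_gcdr andbT.
  have Dk : D %| g1 * k by rewrite mulrC (dvdp_trans (dvdp_gcdr _ _)).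
  have : D %| gcdp (g1 * f) (g1 * k) by rewrite dvdp_gcd dvdp_gcdl.
  rewrite -(eqp_dvdr _ (mulp_gcdr _ _ _)).
  by rewrite (eqp_dvdr _ (eqp_mull _ (_ : gcdp f k %= 1))) ?mulr1 // gcdp_eqp1.
have /dvdpP[e De] := DD'.
have e0 : e != 0 by apply: contraNneq t0 => z; have := gcdp_eq0 (g1 * f) t; rewrite -/D De z mul0r eqxx => /esym/andP[].
have ef : e %| f by rewrite -(dvdp_mul2r _ _ D'0) -De mulrC.
rewrite De size_mul_pred // addnC; congr (_ + _)%N; congr _.-1; apply: eqp_size.
case: fi => _ fi; apply: fi ef; apply: contraNneq tk => e1.
have Dg1 : D %| g1.
  have eu : e %= 1 by rewrite -size_poly_eq1 e1.
  by rewrite De (eqp_dvdl _ (eqp_mulr D' eu)) mul1r dvdp_gcdl.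
have D0 : D != 0 by rewrite De mulf_neq0.
have /dvdpP[t' tE] : D %| t by apply: dvdp_gcdr.
have /dvdpP[g' gE] : D %| g1 * f by apply: dvdp_gcdl.
have cop : coprimep t' g'.
  have := coprimep_div_gcd (p := g1 * f) (q := t); rewrite -/D mulf_neq0 //= => /(_ isT).
  by rewrite {1}gE {1}tE !mulpK // coprimep_sym.
have t'k : t' %| k.
  rewrite -(Gauss_dvdpl _ cop) -(dvdp_mul2r _ _ D0) -tE.
  by rewrite -mulrA -gE -pE.
by rewrite tE dvdp_mul.
Qed.

(* The number of [t] in [s] divisible by the full power of [f] dividing [p]. *)
Definition top_mult s p f := count (fun t => ~~ (t %| p %/ f)) s.

Section Count.
Variables (d : nat) (C : 'M[F]_d) (p : {poly F}).
Hypotheses (p0 : p != 0) (Cs : forall t, t \in invs C -> t %| p).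

Definition avoid g T : {set 'rV[F]_d} :=
  [set v | (v *m mx_eval C g == 0) && all (fun f => v *m mx_eval C (g %/ f) != 0) T].

Lemma ker_card_div f g : irreducible_poly f -> g %| p -> f %| g -> ~~ (f %| p %/ g) ->
  ker_card C g = (ker_card C (g %/ f)%R * q ^ ((size f).-1 * top_mult (invs C) p f))%N.
Proof.
move=> fi gp fg fpg; have [_ _ H3 _] := smith_type_invs C.
rewrite !H3 -expnD; congr (_ ^ _)%N; rewrite /top_mult -sum1_count big_distrr /=.
rewrite [X in (_ + X)%N]big_mkcond -big_split /=; apply: eq_big_seq => t tC.
rewrite (size_gcd_div_irred p0 fi gp (Cs tC) fg fpg).
by case: ifP => _; rewrite ?muln1 ?muln0.
Qed.

(* Under [v (g / f)(C) = 0], the conditions [v (g / h)(C) <> 0] and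
   [v (g / f / h)(C) <> 0] agree because f and h are coprime. *)
Lemma avoid_cons f g T : f != 0 -> uniq (f :: T) -> g != 0 ->
  {in f :: T, forall h, irreducible_poly h /\ h \is monic} -> {in f :: T, forall h, h %| g} ->
  avoid g T = avoid g (f :: T) :|: avoid (g %/ f) T /\
  [disjoint avoid g (f :: T) & avoid (g %/ f) T].
Proof.
move=> f0 /= /andP[fT Tu] g0 Hi Hg.
have fg : f %| g by apply: Hg; rewrite mem_head.
have E v : v *m mx_eval C (g %/ f) = 0 ->
    all (fun h => v *m mx_eval C (g %/ h) != 0) T = all (fun h => v *m mx_eval C (g %/ f %/ h) != 0) T.
  move=> vf; apply: eq_in_all => h hT; congr negb.
  have hfT : h \in f :: T by rewrite inE hT orbT.
  have [hi hm] := Hi _ hfT; have [fi fm] := Hi _ (mem_head f T).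
  have h0 := monic_neq0 hm.
  have /dvdpP[g1 gE] := fg.
  have hg1 : h %| g1.
    have := Hg _ hfT; rewrite gE irred_dvdpM // => /orP[//|].
    by rewrite irred_monic_dvdp // => /eqP hf; rewrite -hf hT in fT.
  have /dvdpP[w g1E] := hg1; rewrite gE mulpK // in vf *.
  rewrite g1E mulpK // in vf *; have -> : w * h * f %/ h = w * f by rewrite mulrAC mulpK.
  apply/eqP/eqP=> H; last by apply: dvdp_row_eval0 H _; rewrite dvdp_mulr.
  have := gcdp_row_eval0 vf H => /dvdp_row_eval0; apply.
  rewrite -(eqp_dvdl _ (mulp_gcdr _ _ _)).
  have cop : coprimep h f.
    by rewrite irred_coprimep // irred_monic_dvdp //; apply: contraNneq fT => <-.
  by rewrite (eqp_dvdl _ (eqp_mull _ (_ : gcdp h f %= 1))) ?mulr1 // gcdp_eqp1.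
have Z v : v *m mx_eval C (g %/ f) = 0 -> v *m mx_eval C g = 0.
  by move=> /dvdp_row_eval0; apply; apply: divp_dvd.
split.
  apply/setP=> v; rewrite !inE /=; case: (eqVneq (v *m mx_eval C (g %/ f)) 0) => [vf|vf].
    by rewrite /= andbF /= Z // eqxx -E.
  by rewrite /= orbF.
rewrite disjoint_subset; apply/subsetP=> v; rewrite !inE /= => /and3P[_ vf _].
by rewrite negb_and vf.
Qed.

(** Inclusion-exclusion as an induction on [T] for all g at once: [avoid g (f :: T)] is [avoid g T]
    without [avoid (g %/ f) T], and the factor of a remaining prime is the same for g and g / f. *)
Lemma card_avoid T g : g %| p -> uniq T ->
  {in T, forall f, irreducible_poly f /\ f \is monic} ->
  {in T, forall f, f %| g} -> {in T, forall f, ~~ (f %| p %/ g)} ->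
  (#|avoid g T|%:R = (ker_card C g)%:R *
     \prod_(f <- T) (1 - ((q ^ ((size f).-1 * top_mult (invs C) p f))%:R)^-1) :> rat).
Proof.
elim: T g => [|f T IH] g gp.
  move=> _ _ _ _; rewrite big_nil mulr1; congr _%:R; apply: eq_card => v.
  by rewrite !inE andbT.
move=> /= Tu Hi Hg Hk; have g0 : g != 0 by apply: dvdpN0 gp p0.
have [fi fm] := Hi _ (mem_head _ _); have f0 := monic_neq0 fm.
have [fT Tu'] := andP Tu.
have fg : f %| g by apply: Hg; rewrite mem_head.
have fk : ~~ (f %| p %/ g) by apply: Hk; rewrite mem_head.
have [AE Adis] := avoid_cons f0 Tu g0 Hi Hg.
have sub h : h \in T -> h \in f :: T by rewrite inE orbC => ->.
have dvd_div h : h \in T -> h %| g %/ f.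
  move=> hT; have [hi hm] := Hi _ (sub _ hT).
  have := Hg _ (sub _ hT); rewrite -{1}(divpK fg) irred_dvdpM // => /orP[//|].
  by rewrite irred_monic_dvdp // => /eqP hf; rewrite -hf hT in fT.
(* Cancelling f only adds f to the cofactor, so g / f keeps the full powers of the remaining
   primes. *)
have pgf : p %/ (g %/ f) = p %/ g * f.
  have pE : p = p %/ g * f * (g %/ f) by rewrite mulrAC -mulrA divpK // divpK.
  by rewrite {1}pE mulpK // dvdp_div_eq0.
have E1 := IH g gp Tu' (fun h hT => Hi h (sub h hT)) (fun h hT => Hg h (sub h hT))
  (fun h hT => Hk h (sub h hT)).
have pk : {in T, forall h, ~~ (h %| p %/ (g %/ f))}.
  move=> h hT; have [hi hm] := Hi _ (sub _ hT).
  rewrite pgf irred_dvdpM // negb_or Hk ?sub //= irred_monic_dvdp //.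
  by apply: contraNneq fT => <-.
have E2 := IH _ (dvdp_trans (divp_dvd fg) gp) Tu' (fun h hT => Hi h (sub h hT)) dvd_div pk.
rewrite big_cons; move: E1; rewrite AE cardsU disjoint_setI0 // cards0 subn0 natrD E2.
rewrite (ker_card_div fi gp fg fk) natrM.
have : (q ^ ((size f).-1 * top_mult (invs C) p f))%:R != 0 :> rat.
  by rewrite pnatr_eq0 -lt0n expn_gt0; apply/orP; left; apply/card_gt0P; exists 0.
move: (_%:R) (_%:R) (_%:R) (\prod_(_ <- T) _) => X A Q Z Q0 E1.
by apply: (addIr (X * Z)); rewrite E1; field.
Qed.

(** The case g = p with all primes of p: a vector has order p iff no p / f kills it, and the kernel
    of p(C) is the whole space. *)
Lemma card_cyc_vectors m S : p \is monic -> size p = m.+2 -> mx_eval C p = 0 ->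
  irred_divisors p S ->
  (#|cyc_vectors m C|%:R = (q ^ d)%:R *
     \prod_(f <- S) (1 - ((q ^ ((size f).-1 * top_mult (invs C) p f))%:R)^-1) :> rat).
Proof.
move=> pm sp Cp HS; have [Su SP] := HS.
have -> : (q ^ d)%N = ker_card C p.
  rewrite /ker_card Cp -[d in LHS]mul1n -card_mx -cardsT; apply: eq_card => v.
  by rewrite !inE mulmx0 eqxx.
rewrite -card_avoid ?dvdpp //.
- congr _%:R; apply: eq_card => v; rewrite !inE Cp mulmx0 eqxx /=.
  apply/idP/allP => [vf f /SP[fm [f1 _] fp]|H].
    apply/eqP => vpf; have f0 := monic_neq0 fm.
    have pf0 : p %/ f != 0 by rewrite dvdp_div_eq0.
    have sz : (size (p %/ f)%R <= m.+1)%N.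
      by rewrite size_divp // sp; move: f1; move: (size (polyseq f)) => a; lia.
    move: vpf; rewrite -(poly_rV_K sz) -mul_krylov => /(congr1 (mulmx^~ (pinvmx (krylov m v C)))).
    rewrite mul0mx -mulmxA mulmxVp // mulmx1 => E.
    by rewrite -(poly_rV_K sz) E linear0 eqxx in pf0.
  apply: (ann_krylov_free sp); apply: (ann_criterion p0 HS); first by rewrite Cp mulmx0.
  by move=> f /H.
- by move=> f /SP[].
- by move=> f /SP[].
move=> f /SP[_ [f1 _] _]; rewrite divpp // dvdp1; by rewrite gtn_eqF.
Qed.

End Count.
End CyclicVectors.

(** * The numbers c_f *)

Section Conjugate.
Implicit Types (mu : seq nat) (q e l i : nat).
Local Open Scope nat_scope.

Lemma conjp_cons l mu i : conjp (l :: mu) i = (i <= l) + conjp mu i.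
Proof. by []. Qed.

Lemma conjp_anti mu i : conjp mu i.+1 <= conjp mu i.
Proof. by apply: sub_count => x; apply: ltnW. Qed.

Lemma conjp0 mu l i : all (fun x => x <= l) mu -> l < i -> conjp mu i = 0.
Proof.
move=> /allP H li; apply/eqP; rewrite eqn0Ngt -has_count; apply/hasPn => x /H xl.
by rewrite -ltnNge (leq_ltn_trans xl).
Qed.

Lemma sum_conjp mu l : all (fun x => x <= l) mu -> \sum_(1 <= i < l.+1) conjp mu i = sumn mu.
Proof.
elim: mu => [|x mu IH] /=; first by rewrite big1.
case/andP=> xl /IH {}IH.
rewrite big_split /= IH; congr (_ + _).
rewrite (big_cat_nat (n := x.+1)) //= [X in _ + X]big1_seq ?addn0 => [|i]; last first.
  by rewrite mem_index_iota => /andP[_ /andP[xi _]]; rewrite leqNgt xi.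
rewrite (eq_big_nat _ _ (F2 := fun=> 1)) => [|i /andP[_]]; last by rewrite ltnS => ->.
by rewrite sum_nat_const_nat subn1 muln1.
Qed.

Lemma sum_conjp_diff mu l : all (fun x => x <= l) mu ->
  \sum_(1 <= i < l.+1) i * (conjp mu i - conjp mu i.+1) = sumn mu.
Proof.
move=> H; rewrite -(sum_conjp H).
under eq_bigr => i _ do rewrite mulnC.
(* Abel summation; the boundary term makes the induction on [l] work and vanishes at a bound on the
   parts. *)
suff : \sum_(1 <= i < l.+1) (conjp mu i - conjp mu i.+1) * i + conjp mu l.+1 * l =
       \sum_(1 <= i < l.+1) conjp mu i by rewrite (conjp0 H) // addn0.
elim: l {H} => [|l IH]; first by rewrite !big_geq ?muln0.
rewrite (big_nat_recr l.+1) //= [RHS](big_nat_recr l.+1) //= -IH -!addnA; congr (_ + _).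
by have := conjp_anti mu l.+1; nia.
Qed.

End Conjugate.

Section ConjugateProduct.
Implicit Types (mu : seq nat) (q e l i : nat).

Definition cf_term q e mu i : rat :=
  let H := (\sum_(1 <= t < i.+1) conjp mu t)%N in
  \prod_(1 <= j < (conjp mu i - conjp mu i.+1).+1) ((q ^ (e * H))%:R - (q ^ (e * (H - j)))%:R).

(** Above the largest part all factors are empty products. This gives c_f of [mu] and of [l :: mu] a
    common range. *)
Lemma cf_bound q e mu l : all (fun x => x <= l)%N mu ->
  cf q e mu = \prod_(1 <= i < l.+1) cf_term q e mu i.
Proof.
move=> H; set B := (\max_(x <- mu) x)%N.
have Bl : (B <= l)%N by apply/bigmax_leqP_seq => x xm _; apply: (allP H).
have HB : all (fun x => x <= B)%N mu by apply/allP => x xm; apply: leq_bigmax_seq.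
rewrite [RHS](big_cat_nat (n := B.+1)) //= [X in _ * X]big1_seq ?mulr1 // => i.
rewrite mem_index_iota => /andP[_ /andP[Bi _]].
by rewrite /cf_term !(conjp0 HB) ?big_geq // ltnW.
Qed.

(** A new largest part l raises the conjugate parts up to index l by one: h_i becomes h_i + i, m_l
    grows by one and the smaller m_i stay. Each old factor of index i gains q^(e i), in total q^(e
    |mu|) because |mu| is the sum of the i m_i; the new factor j = m_l + 1, for the old m_l, is the
    last bracket. *)
Lemma cf_cons q e l mu : (0 < q)%N -> (0 < l)%N -> all (fun x => x <= l)%N mu ->
  cf q e (l :: mu) = cf q e mu * (q ^ (e * sumn mu))%:R *
    ((q ^ (e * (sumn mu + l)))%:R * (1 - ((q ^ (e * count_mem l (l :: mu)))%:R)^-1)).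
Proof.
move=> q0 l0 H; have qn0 n : (q ^ n)%:R != 0 :> rat by rewrite pnatr_eq0 -lt0n expn_gt0 q0.
rewrite (cf_bound q e (l := l)) /= ?leqnn // (cf_bound q e H).
pose c i := conjp mu i; pose M i := (c i - c i.+1)%N.
pose G i := (\sum_(1 <= t < i.+1) c t)%N.
have SE i : (i <= l)%N -> (\sum_(1 <= t < i.+1) conjp (l :: mu) t)%N = (G i + i)%N.
  move=> il; rewrite /G addnC (eq_big_nat _ _ (F2 := fun t => 1 + c t)%N) => [|t /andP[_ ti]].
    by rewrite big_split /= sum_nat_const_nat subn1 muln1.
  by rewrite conjp_cons (leq_trans _ il).
have MS i : (0 < i)%N -> (M i <= G i)%N.
  by case: i => // i _; rewrite /G big_nat_recr //= /M (leq_trans (leq_subr _ _)) // leq_addl.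
have fac i j : (j <= G i)%N ->
    (q ^ (e * (G i + i)))%:R - (q ^ (e * (G i + i - j)))%:R =
    (q ^ (e * i))%:R * ((q ^ (e * G i))%:R - (q ^ (e * (G i - j)))%:R) :> rat.
  move=> jS; rewrite -addnBAC // !mulnDr !expnD !natrM; ring.
have cl : c l.+1 = 0%N by apply: conjp0 H _.
have facprod i : (0 < i)%N -> \prod_(1 <= j < (M i).+1)
    ((q ^ (e * (G i + i)))%:R - (q ^ (e * (G i + i - j)))%:R) =
    (q ^ (e * (i * M i)))%:R * cf_term q e mu i :> rat.
  move=> i0; rewrite /cf_term -/(M i) -/(G i).
  rewrite (eq_big_nat _ _ (F2 := fun j => (q ^ (e * i))%:R * ((q ^ (e * G i))%:R - (q ^ (e * (G i - j)))%:R))).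
    by rewrite big_split /= prodr_const_nat subn1 -natrX -expnM mulnA.
  by move=> j /andP[_ ji]; apply: fac; apply: leq_trans (MS _ i0).
have lt_term i : (0 < i < l)%N ->
    cf_term q e (l :: mu) i = (q ^ (e * (i * M i)))%:R * cf_term q e mu i.
  case/andP=> i0 il; rewrite -facprod // {1}/cf_term SE ?(ltnW il) //.
  by rewrite !conjp_cons il (ltnW il) subnDl.
have Gl : G l = sumn mu by apply: sum_conjp.
have last_term : cf_term q e (l :: mu) l = (q ^ (e * (l * M l)))%:R * cf_term q e mu l *
    ((q ^ (e * (G l + l)))%:R - (q ^ (e * (G l + l - (M l).+1)))%:R).
  rewrite -facprod // {1}/cf_term SE // !conjp_cons leqnn ltnn -/(c _) -/(c _) cl /M cl.
  by rewrite add0n !subn0 add1n big_nat_recr.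
rewrite -(prednK l0) big_nat_recr //= (prednK l0) last_term.
rewrite (eq_big_nat _ _ (F2 := fun i => (q ^ (e * (i * M i)))%:R * cf_term q e mu i)); last first.
  exact: lt_term.
rewrite big_split /= [X in _ = X * _ * _]big_nat_recr //= -Gl.
have -> : (q ^ (e * G l))%:R = (\prod_(1 <= i < l) (q ^ (e * (i * M i)))%:R) * (q ^ (e * (l * M l)))%:R :> rat.
  rewrite Gl -(sum_conjp_diff H) big_nat_recr //= mulnDr expnD natrM; congr (_ * _).
  by rewrite big_distrr /= expn_sum natr_prod.
have -> : count_mem l mu = M l.
  rewrite /M cl subn0; apply: eq_in_count => x xm; have := allP H x xm.
  by rewrite /= eqn_leq => ->.
rewrite eqxx add1n.
have -> : (q ^ (e * (G l + l)))%:R - (q ^ (e * (G l + l - (M l).+1)))%:R =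
  (q ^ (e * (G l + l)))%:R * (1 - ((q ^ (e * (M l).+1))%:R)^-1) :> rat.
  have ml : ((M l).+1 <= G l + l)%N by have := MS l l0; lia.
  rewrite -{1 3}(subnK ml) mulnDr expnD natrM; field; exact: qn0.
ring.
Qed.

Lemma cf_nil q e : cf q e [::] = 1.
Proof. by rewrite /cf big_nil big_geq. Qed.

End ConjugateProduct.

(** * Valuations and the partitions Phi *)

Section Valuation.
Variable F : finFieldType.
Implicit Types (f g h p t : {poly F}) (s T S : seq {poly F}) (d m n e : nat).
Local Notation q := #|F|.

(** The search range [e < size g] of [nu] is wide enough, since f^e has degree at least e. *)
Lemma nu_dvdp f g n : irreducible_poly f -> g != 0 -> (f ^+ n %| g) = (n <= nu f g)%N.
Proof.
move=> [f1 _] g0; have f0 : f != 0 by rewrite -size_poly_gt0 ltnW.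
have lt e : f ^+ e %| g -> (e < size g)%N.
  move=> /(dvdp_leq g0); apply: leq_trans.
  rewrite -(prednK (n := size (f ^+ e))) ?size_poly_gt0 ?expf_neq0 // size_exp ltnS.
  by rewrite leq_pmull // -subn1 subn_gt0.
apply/idP/idP => [fg|nn].
  exact: (leq_bigmax_cond (F := fun e : 'I_(size g) => e : nat) (Ordinal (lt _ fg)) fg).
have g00 : (0 < size g)%N by rewrite size_poly_gt0.
pose A := [pred e : 'I_(size g) | f ^+ e %| g].
have c0 : (0 < #|A|)%N by apply/card_gt0P; exists (Ordinal g00); rewrite inE expr0 dvd1p.
have [i fi E] := eq_bigmax_cond (fun e : 'I_(size g) => e : nat) c0.
have {}E : nu f g = i by [].
by apply: dvdp_trans fi; rewrite dvdp_exp2l // -E.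
Qed.

Lemma nu_expM f b n : irreducible_poly f -> b != 0 -> ~~ (f %| b) -> nu f (f ^+ n * b) = n.
Proof.
move=> fi b0 fb; have f0 : f != 0 by case: fi => f1 _; rewrite -size_poly_gt0 ltnW.
have g0 : f ^+ n * b != 0 by rewrite mulf_neq0 // expf_neq0.
apply/eqP; rewrite eqn_leq -(nu_dvdp n fi g0) dvdp_mulIl andbT leqNgt.
rewrite -(nu_dvdp n.+1 fi g0) exprSr dvdp_mul2l ?expf_neq0 //.
Qed.

Lemma nu_factor f g : irreducible_poly f -> g != 0 ->
  exists2 b, g = f ^+ nu f g * b & b != 0 /\ ~~ (f %| b).
Proof.
move=> fi g0; have [n [b [E fb]]] := exp_factor g0 fi.
have b0 : b != 0 by apply: contraNneq g0 => z; rewrite E z mulr0.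
by exists b => //; rewrite {2}E nu_expM.
Qed.

Lemma nuM f g h : irreducible_poly f -> g != 0 -> h != 0 -> nu f (g * h) = (nu f g + nu f h)%N.
Proof.
move=> fi g0 h0; have [a aE [a0 fa]] := nu_factor fi g0; have [b bE [b0 fb]] := nu_factor fi h0.
rewrite {1}aE {1}bE mulrACA -exprD nu_expM ?mulf_neq0 //.
by rewrite irred_dvdpM // negb_or fa.
Qed.

Lemma nu_gt0 f g : irreducible_poly f -> g != 0 -> (0 < nu f g)%N = (f %| g).
Proof. by move=> fi g0; rewrite -(nu_dvdp 1 fi g0) expr1. Qed.

Lemma nu1 f : irreducible_poly f -> nu f 1 = 0%N.
Proof.
move=> fi; apply/eqP; rewrite eqn0Ngt nu_gt0 ?oner_neq0 // dvdp1.
by case: fi => f1 _; rewrite gtn_eqF.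
Qed.

Lemma nu_irred f g : irreducible_poly f -> irreducible_poly g -> f \is monic -> g \is monic ->
  nu f g = (f == g).
Proof.
move=> fi gi fm gm; case: eqVneq => [<-|fg].
  rewrite -[X in nu _ X]expr1 -[X in nu _ X]mulr1 nu_expM ?oner_neq0 // dvdp1.
  by case: fi => f1 _; rewrite gtn_eqF.
by apply/eqP; rewrite eqn0Ngt (nu_gt0 fi (monic_neq0 gm)) irred_monic_dvdp.
Qed.

Lemma leq_nu f g h : irreducible_poly f -> h != 0 -> g %| h -> (nu f g <= nu f h)%N.
Proof.
move=> fi h0 gh; have g0 : g != 0 by apply: dvdpN0 gh h0.
by rewrite -(nu_dvdp _ fi h0); apply: dvdp_trans gh; rewrite nu_dvdp.
Qed.

(** Dividing p by f lowers only the valuation at f, so a divisor t survives unless it has the full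
    power of f. *)
Lemma dvdp_div_irred f t p : irreducible_poly f -> p != 0 -> t %| p -> f %| p ->
  (t %| p %/ f) = (nu f t != nu f p).
Proof.
move=> fi p0 tp fp; have f0 : f != 0 by case: fi => f1 _; rewrite -size_poly_gt0 ltnW.
have t0 : t != 0 by apply: dvdpN0 tp p0.
have pf0 : p %/ f != 0 by rewrite dvdp_div_eq0.
have pE : nu f p = (nu f (p %/ f)).+1.
  have f1 : ~~ (f %| 1) by rewrite dvdp1; case: fi => f1 _; rewrite gtn_eqF.
  have := nu_expM 1 fi (oner_neq0 _) f1; rewrite expr1 mulr1 => nuff.
  by rewrite -{1}(divpK fp) nuM // nuff addn1.
apply/idP/idP => [/(leq_nu fi pf0) H|H]; first by rewrite pE ltn_eqF.
have ltn : (nu f t <= nu f (p %/ f))%N.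
  by rewrite -ltnS -pE ltn_neqAle H leq_nu.
have [b bE [b0 fb]] := nu_factor fi pf0; have [c cE [c0 fc]] := nu_factor fi t0.
rewrite cE bE dvdp_mul ?dvdp_exp2l //.
have : c %| f ^+ (nu f (p %/ f)).+1 * b.
  apply: dvdp_trans (_ : t %| _); first by rewrite cE dvdp_mulIr.
  by rewrite exprSr mulrAC -bE divpK.
rewrite Gauss_dvdpr // coprimep_sym coprimep_expl // irred_coprimep //.
Qed.

Lemma size_nu_sum g S : g \is monic -> uniq S ->
  {in S, forall f, f \is monic /\ irreducible_poly f} ->
  (forall f, f \is monic -> irreducible_poly f -> f %| g -> f \in S) ->
  (size g).-1 = (\sum_(f <- S) (size f).-1 * nu f g)%N.
Proof.
move=> gm Su HS SP; have [n] := ubnP (size g); elim: n g gm SP => // n IH g gm SP gn.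
have g0 := monic_neq0 gm.
have [g1|/ex_irred_dvdp[h [hm hi /dvdpP[g' gE]]]] := leqP (size g) 1.
  have -> : g = 1.
    by apply/eqP; rewrite -eqp_monic ?monic1 // -size_poly_eq1 eqn_leq g1 size_poly_gt0.
  rewrite size_poly1 big1_seq // => f /= /HS[_ fi]; by rewrite nu1 ?muln0.
have h0 := monic_neq0 hm; have g'0 : g' != 0 by apply: contraNneq g0 => z; rewrite gE z mul0r.
have g'm : g' \is monic by move: gm; rewrite gE monicMr.
have hS : h \in S by apply: SP; rewrite // gE dvdp_mulIr.
rewrite gE size_mul_pred // (IH g') //; first last.
- move: gn; rewrite gE size_Mmonic //; case: (hi) => h1 _; move: h1.
  by move: (size (polyseq h)) (size (polyseq g')) => a b; lia.
- by move=> f fm fi fg; apply: SP => //; rewrite gE dvdp_mulr.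
transitivity (\sum_(f <- S) ((size f).-1 * nu f g' + (size f).-1 * (f == h)))%N.
  rewrite big_split /=; congr (_ + _)%N.
  rewrite (bigD1_seq h) //= eqxx muln1 big1 ?addn0 // => f /negPf ->.
  by rewrite muln0.
apply: eq_big_seq => f /HS[fm fi]; rewrite nuM // mulnDr; congr (_ + _ * _)%N.
by rewrite nu_irred.
Qed.

Lemma chain_rcons s p : chain (rcons s p) ->
  [/\ chain s, p \is monic & {in s, forall t, t %| p}].
Proof.
case=> mon dvd; split.
- split=> [i si|i j /andP[ij js]].
    by have := mon i; rewrite size_rcons nth_rcons si; apply; apply: ltnW.
  have := dvd i j; rewrite size_rcons ij !nth_rcons js (leq_ltn_trans ij js) /=; apply.
  exact: ltnW.
- by have := mon (size s); rewrite size_rcons nth_rcons ltnn eqxx; apply.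
move=> t ts; have ix : (index t s < size s)%N by rewrite index_mem.
have := dvd (index t s) (size s); rewrite size_rcons !nth_rcons ltnn eqxx ix nth_index //.
by apply; rewrite ltnSn ltnW.
Qed.

Lemma chain_behead a s : chain (a :: s) ->
  [/\ chain s, a \is monic & {in s, forall t, a %| t}].
Proof.
case=> mon dvd; split.
- by split=> [i /(mon i.+1)|i j /(dvd i.+1 j.+1)].
- exact: (mon 0%N).
by move=> t ts; have := dvd 0%N (index t s).+1; rewrite /= ltnS index_mem nth_index //; apply.
Qed.

Lemma chain_monic s : chain s -> {in s, forall t, t \is monic}.
Proof. by case=> mon _ t ts; rewrite -(nth_index 0 ts) mon // index_mem. Qed.

(** Valuations do not decrease along a chain, so dropping everything before the first positive one
    keeps exactly the positive ones. *)
Lemma PhiE s f : irreducible_poly f -> chain s ->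
  Phi s f = rev [seq x <- [seq nu f t | t <- s] | (0 < x)%N].
Proof.
move=> fi ch; rewrite /Phi; congr rev; elim: s ch => //= a s IH /chain_behead[ch am ad].
case: ifP => a0; last by rewrite /= IH.
rewrite drop0; congr cons; symmetry; apply/all_filterP/allP => x /mapP[t ts ->].
apply: leq_trans a0 _; apply: leq_nu => //; last exact: ad.
exact: monic_neq0 (chain_monic ch ts).
Qed.

Lemma Phi_extend m s p f : irreducible_poly f -> chain (nseq m 1 ++ rcons s p) -> chain s ->
  p != 0 -> f %| p -> Phi (nseq m 1 ++ rcons s p) f = nu f p :: Phi s f.
Proof.
move=> fi ch chs p0 fp; rewrite !PhiE // map_cat filter_cat map_rcons filter_rcons.
rewrite nu_gt0 // fp rev_cat rev_rcons.
have -> : [seq x <- [seq nu f t | t <- nseq m 1] | (0 < x)%N] = [::].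
  by rewrite map_nseq nu1 // filter_nseq.
by rewrite cats0.
Qed.

Lemma Phi_nil s f : irreducible_poly f -> chain s -> {in s, forall t, ~~ (f %| t)} ->
  Phi s f = [::].
Proof.
move=> fi ch H; rewrite PhiE // (eq_in_filter (a2 := pred0)) ?filter_pred0 //.
move=> x /mapP[t ts ->]; have t0 := monic_neq0 (chain_monic ch ts).
by rewrite nu_gt0 // (negPf (H _ ts)).
Qed.

Lemma sumn_Phi s f : irreducible_poly f -> chain s ->
  sumn (Phi s f) = (\sum_(t <- s) nu f t)%N.
Proof.
move=> fi ch; rewrite PhiE // sumn_rev sumnE big_filter big_mkcond big_map.
by apply: eq_bigr => t _; case: (nu f t).
Qed.

Lemma degsum_nu s S : chain s -> uniq S ->
  {in S, forall f, f \is monic /\ irreducible_poly f} ->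
  (forall f t, t \in s -> f \is monic -> irreducible_poly f -> f %| t -> f \in S) ->
  degsum s = (\sum_(f <- S) (size f).-1 * sumn (Phi s f))%N.
Proof.
move=> ch Su HS SP; transitivity (\sum_(f <- S) \sum_(t <- s) (size f).-1 * nu f t)%N.
  rewrite exchange_big; apply: eq_big_seq => t ts; apply: size_nu_sum => //.
    exact: chain_monic ch _ ts.
  by move=> f; apply: SP ts.
by apply: eq_big_seq => f /HS[_ fi]; rewrite sumn_Phi // big_distrr.
Qed.

End Valuation.

(** * Matrices with given invariant factors: the square case *)

Section ClassCard.
Variable F : finFieldType.
Implicit Types (f g h p t : {poly F}) (s T S : seq {poly F}) (d m n e : nat).
Local Notation q := #|F|.

Lemma card_field_gt0 : (0 < q)%N.
Proof. by apply/card_gt0P; exists 0. Qed.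

Lemma monic_size1 p : p \is monic -> (size p <= 1)%N -> p = 1.
Proof.
move=> pm p1; apply/eqP; rewrite -eqp_monic ?monic1 // -size_poly_eq1 eqn_leq p1.
by rewrite size_poly_gt0 monic_neq0.
Qed.

Lemma chain_catr s s1 : chain (s ++ s1) -> chain s1.
Proof. by elim: s => //= a s IH /chain_behead[/IH]. Qed.

(** If the first entry of a chain is not constant, all entries have positive degree and the total
    degree is at least the length. A deficit must therefore come from leading ones. *)
Lemma ones_prefix s j : chain s -> (degsum s + j <= size s)%N -> exists s', s = nseq j 1 ++ s'.
Proof.
elim: s j => [|a s IH] [|j] //=; first by exists [::].
- by rewrite addnS.
- by exists (a :: s).
move=> ch; have [chs am ad] := chain_behead ch.
have [a1|a1] := leqP (size a) 1.
  have -> := monic_size1 am a1; rewrite /degsum big_cons size_poly1 add0n addnS ltnS.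
  by move=> /IH[] // s' ->; exists s'.
rewrite addnS ltnS => H; suff : (size s < degsum (a :: s))%N by rewrite ltnNge (leq_trans _ H) ?leq_addr.
rewrite /degsum big_cons -add1n leq_add //; first by rewrite -ltnS prednK // ltnW.
rewrite -sum1_size !big_seq leq_sum // => t ts.
have tm := chain_monic chs ts.
have := dvdp_leq (monic_neq0 tm) (ad t ts); move: a1.
by move: (size (polyseq a)) (size (polyseq t)) => x y; lia.
Qed.

(** If the last entry has degree m + 1, the total degree of the others is m less than their number.
    This forces m leading ones, and what remains is balanced again. *)
Lemma chain_peel s : chain s -> degsum s = size s -> (0 < size s)%N ->
  exists m s' p, [/\ s = nseq m 1 ++ rcons s' p, p \is monic, size p = m.+2,
    chain s' /\ degsum s' = size s' & {in s', forall t, t %| p}].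
Proof.
case/lastP: s => // s p ch; rewrite degsum_rcons size_rcons => ds _.
have [chs pm pd] := chain_rcons ch.
case sp : (size p) ds => [|[|m]] ds.
- by move/eqP: sp; rewrite size_poly_eq0 (negPf (monic_neq0 pm)).
- suff : degsum s = 0%N by move: ds => /= ; lia.
  rewrite /degsum big1_seq // => t /andP[_ ts]; have := dvdp_leq (monic_neq0 pm) (pd t ts).
  by rewrite sp; case: (size t) => [|[]].
have [|s' sE] := ones_prefix (j := m) chs; first by move: ds => /=; lia.
exists m, s', p; split=> //; first by rewrite sE rcons_cat.
- split; first by move: chs; rewrite sE => /chain_catr.
  by move: ds; rewrite sE degsum_cat degsum_nseq1 size_cat size_nseq /=; lia.
by move=> t ts; apply: pd; rewrite sE mem_cat ts orbT.
Qed.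

Definition class_weight s S : rat := \prod_(f <- S) cf q (size f).-1 (Phi s f).

(* [S] may contain primes that divide no element of [s], so that the same [S] serves in the
   whole induction. *)
Definition covers S s : Prop :=
  [/\ uniq S, {in S, forall f, f \is monic /\ irreducible_poly f} &
      forall f t, t \in s -> f \is monic -> irreducible_poly f -> f %| t -> f \in S].

Lemma qn_neq0 n : (q ^ n)%:R != 0 :> rat.
Proof. by rewrite pnatr_eq0 -lt0n expn_gt0 card_field_gt0. Qed.

Lemma top_mult_count s p f : irreducible_poly f -> p != 0 -> chain s -> f %| p ->
  {in s, forall t, t %| p} -> top_mult s p f = count_mem (nu f p) (Phi s f).
Proof.
move=> fi p0 ch fp sp; rewrite PhiE // count_rev count_filter count_map /top_mult.
apply: eq_in_count => t ts /=; rewrite (dvdp_div_irred fi p0 (sp _ ts) fp) negbK.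
by apply/eqP/andP => [->|[/eqP]//]; rewrite eqxx nu_gt0.
Qed.

(** The product of [cf_cons] over [S]. The powers of q collapse because the degrees of the f times
    the sizes of their partitions add up to the total degree; primes not dividing p have empty
    partitions. *)
Lemma class_weight_extend m s p S (t := nseq m 1 ++ rcons s p : seq {poly F}) : chain t -> p \is monic ->
  size p = m.+2 -> chain s -> {in s, forall u, u %| p} -> degsum s = size s ->
  covers S t ->
  class_weight t S = class_weight s S * (q ^ size s)%:R *
   ((q ^ (m.+1 + size s))%:R *
    \prod_(f <- S | f %| p) (1 - ((q ^ ((size f).-1 * top_mult t p f))%:R)^-1)).
Proof.
move=> ch pm sp chs pd ds [Su SI SP]; have p0 := monic_neq0 pm.
have st : {subset s <= t} by move=> u us; rewrite mem_cat mem_rcons inE us !orbT.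
have pt : p \in t by rewrite mem_cat mem_rcons mem_head orbT.
have td : {in t, forall u, u %| p}.
  move=> u; rewrite mem_cat mem_nseq mem_rcons inE => /or3P[/andP[_ /eqP->]|/eqP->|/pd//].
    exact: dvd1p.
  exact: dvdpp.
have dt : degsum t = (m.+1 + size s)%N.
  by rewrite degsum_cat degsum_nseq1 degsum_rcons ds sp add0n addnC.
have -> : (q ^ size s)%:R = \prod_(f <- S) (q ^ ((size f).-1 * sumn (Phi s f)))%:R :> rat.
  rewrite -ds (degsum_nu chs Su SI) => [|f u us]; last exact: SP (st u us).
  by rewrite expn_sum natr_prod.
have -> : (q ^ (m.+1 + size s))%:R = \prod_(f <- S) (q ^ ((size f).-1 * sumn (Phi t f)))%:R :> rat.
  by rewrite -dt (degsum_nu ch Su SI) // expn_sum natr_prod.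
rewrite [X in _ * (_ * X)]big_mkcond -!big_split /=; apply: eq_big_seq => f /SI[fm fi].
have [fp|fp] := boolP (f %| p); last first.
  have nf u : u %| p -> ~~ (f %| u) by move=> up; apply: contra fp => /dvdp_trans; apply.
  rewrite (Phi_nil fi ch) => [|u /td/nf//]; rewrite (Phi_nil fi chs) => [|u /pd/nf//].
  by rewrite cf_nil muln0 expn0 !mulr1.
rewrite (top_mult_count fi p0 ch fp td) (Phi_extend fi ch chs p0 fp).
rewrite cf_cons ?card_field_gt0 ?nu_gt0 //; last first.
  rewrite PhiE // all_rev all_filter all_map; apply/allP => u us /=; apply/implyP => _.
  by apply: leq_nu => //; apply: pd.
by rewrite /= [(sumn _ + _)%N]addnC.
Qed.

Lemma glcard_neq0 n : (glcard F n)%:R != 0 :> rat.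
Proof.
by rewrite pnatr_eq0 -lt0n; apply/card_gt0P; exists 1%:M; rewrite inE unitmx1.
Qed.

Lemma glcard0 : glcard F 0 = 1%N.
Proof.
rewrite -[RHS](card_mx F 0 0) /glcard -cardsT; apply: eq_card => A.
by rewrite !inE flatmx0 unitmxE det_mx00 unitr1.
Qed.

Lemma covers_sub S s s1 : {subset s <= s1} -> covers S s1 -> covers S s.
Proof. by move=> st [? ? SP]; split=> // f u us; apply: SP; apply: st. Qed.

(** So [class_weight] is the order of the centraliser of a matrix in the class. In the induction
    class sizes obey [class_count_step], weights obey [class_weight_extend], and the number Y of
    vectors of maximal order enters both. *)
Lemma class_card s S d : size s = d -> chain s -> degsum s = d -> covers S s ->
  #|type_class d s|%:R * class_weight s S = (glcard F d)%:R.
Proof.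
have [n] := ubnP d; elim: n d s => // n IH d s dn sd ch ds cov.
have [d0|d_gt0] := posnP d.
  rewrite d0 in sd *; have s0 : s = [::] by apply: size0nil.
  rewrite glcard0 s0 /class_weight big1_seq => [|f _]; last by rewrite /Phi /= cf_nil.
  rewrite mulr1 -[RHS]/(1%:R); congr _%:R; rewrite -[RHS](card_mx F 0 0) -cardsT.
  by apply: eq_card => C; rewrite !inE; apply/eqP/size0nil; rewrite size_invs.
have [||m [s' [p [sE pm sp [chs' ds'] pd]]]] := chain_peel ch; rewrite ?ds ?sd //.
have [Su SI SP] := cov; have p0 := monic_neq0 pm.
set d' := size s' in ds'.
have dE : d = (m.+1 + d')%N.
  by rewrite -sd sE size_cat size_nseq size_rcons addnS.
have lp : last 1 s' %| p.
  by have := mem_last 1 s'; rewrite inE => /predU1P[->|/pd//]; rewrite dvd1p.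
have step := class_count_step d' pm sp lp.
have sub : {subset s' <= s}.
  by move=> u us; rewrite sE mem_cat mem_rcons inE us !orbT.
have cov' := covers_sub sub cov.
have {}IH := IH d' s' _ (erefl _) chs' ds' cov'.
have /IH {}IH : (d' < n)%N by move: dn; rewrite dE; lia.
set Y := (q ^ (m.+1 + d'))%:R *
  \prod_(f <- S | f %| p) (1 - ((q ^ ((size f).-1 * top_mult s p f))%:R)^-1) : rat.
have W : class_weight s S = class_weight s' S * (q ^ d')%:R * Y.
  by rewrite {1}sE class_weight_extend -?sE.
have td : {in s, forall u, u %| p}.
  move=> u; rewrite sE mem_cat mem_nseq mem_rcons inE => /or3P[/andP[_ /eqP->]|/eqP->|/pd//].
    exact: dvd1p.
  exact: dvdpp.
have HS : irred_divisors p [seq f <- S | f %| p].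
  split; first exact: filter_uniq.
  move=> f; rewrite mem_filter; split=> [/andP[fp /SI[fm fi]]//|[fm fi fp]].
  by rewrite fp (SP _ p) // sE mem_cat mem_rcons mem_head orbT.
have cyc (C : 'M[F]_(m.+1 + d')) : invs C = s -> #|cyc_vectors m C|%:R = Y.
  move=> Cs; have Cp : mx_eval C p = 0 by apply: (class_eval0 (s := s')); rewrite -sE.
  rewrite (card_cyc_vectors p0 _ pm sp Cp HS) ?Cs //.
  by rewrite big_filter.
rewrite dE; move: step; rewrite -sE => /(congr1 (fun x : nat => x%:R : rat)).
rewrite !natrM natr_sum.
rewrite (eq_bigr (fun=> Y)) => [|C]; last by rewrite inE => /eqP /cyc.
rewrite sumr_const -[Y *+ _]mulr_natl => step.
apply: (mulfI (glcard_neq0 d')); rewrite W.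
transitivity (#|type_class (m.+1 + d') s|%:R * Y * (q ^ d')%:R * (glcard F d')%:R * class_weight s' S); first by ring.
by rewrite -step -IH; ring.
Qed.

End ClassCard.

(** * Largest invariant subspace of a rectangular matrix *)

Section Observability.
Variable F : finFieldType.
Implicit Types (k s d r : nat).

(* The smallest row space containing the rows of [Bb] and stable under [Bt]; as a space of
   linear forms, it is the annihilator of the largest invariant subspace of [col_mx Bt Bb]. *)
Definition obs_space k s (Bt : 'M[F]_k) (Bb : 'M[F]_(s, k)) : 'M[F]_k :=
  (\bigcap_(X : 'M[F]_k | (Bb <= X)%MS && stablemx X Bt) X)%MS.

(** Observability in the sense of control theory: the pair has no nonzero invariant subspace. *)
Definition observable k s (Bt : 'M[F]_k) (Bb : 'M[F]_(s, k)) : bool :=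
  row_full (obs_space Bt Bb).

Lemma obs_space_sub k s (Bt : 'M[F]_k) (Bb : 'M_(s, k)) : (Bb <= obs_space Bt Bb)%MS.
Proof. by apply/sub_bigcapmxP => X /andP[]. Qed.

Lemma obs_space_min k s m (Bt : 'M[F]_k) (Bb : 'M_(s, k)) (X : 'M_(m, k)) :
  (Bb <= X)%MS -> (X *m Bt <= X)%MS -> (obs_space Bt Bb <= X)%MS.
Proof.
move=> BX XB; rewrite -(genmxE X); apply: bigcapmx_inf; last exact: submx_refl.
by rewrite genmxE BX genmxE (eqmxMr Bt (genmxE X)).
Qed.

Lemma obs_space_stable k s (Bt : 'M[F]_k) (Bb : 'M_(s, k)) :
  (obs_space Bt Bb *m Bt <= obs_space Bt Bb)%MS.
Proof.
apply/sub_bigcapmxP => X /andP[BX XB].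
exact: submx_trans (submxMr _ (obs_space_min BX XB)) XB.
Qed.

Lemma row_full_le n m1 m2 (A : 'M[F]_(m1, n)) (B : 'M_(m2, n)) :
  (A <= B)%MS -> row_full A -> row_full B.
Proof. by rewrite -!sub1mx => AB /submx_trans; apply. Qed.

Definition stack_pencil k s (Bt : 'M[F]_k) (Bb : 'M[F]_(s, k)) : 'M[{poly F}]_(k + s, k) :=
  col_mx ('X%:M - map_mx polyC Bt) (- map_mx polyC Bb).

Lemma xImB_col k s (Bt : 'M[F]_k) (Bb : 'M[F]_(s, k)) :
  xImB (col_mx Bt Bb) = stack_pencil Bt Bb.
Proof.
rewrite /stack_pencil -xImB_sq; apply/matrixP=> i j; rewrite !mxE.
case: (split_ordP i) => i' ->; rewrite !mxE //=.
by rewrite gtn_eqF ?sub0r // (leq_trans (ltn_ord j)) // leq_addr.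
Qed.

(* Modulo the row module of the pencil, x acts on constant rows as [D] and the rows of [E]
   vanish, so the constant rows in this module form a [D]-stable space containing [E]. *)
Lemma observable_left_inverse r s (D : 'M[F]_r) (E : 'M_(s, r)) : observable D E ->
  exists R, R *m stack_pencil D E = 1%:M.
Proof.
move=> obsE; pose A := stack_pencil D E.
pose good m (X : 'M[F]_(m, r)) := exists R, R *m A = map_mx polyC X.
have sub m m' (X : 'M_(m, r)) (X' : 'M_(m', r)) : good _ X -> (X' <= X)%MS -> good _ X'.
  by move=> [R RA] /submxP[W ->]; exists (map_mx polyC W *m R); rewrite -mulmxA RA -map_mxM.
suff [X [Xg EX XD]] : exists X : 'M_r, [/\ good _ X, (E <= X)%MS & (X *m D <= X)%MS].
  have X1 : (1%:M <= X)%MS by rewrite sub1mx (row_full_le (obs_space_min EX XD) obsE).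
  by have [R RA] := sub _ _ _ _ Xg X1; exists R; rewrite -/A RA map_mx1.
have Eg : good _ E.
  exists (row_mx 0 (- 1%:M)); rewrite /A /stack_pencil mul_row_col mul0mx add0r.
  by rewrite mulNmx mul1mx opprK.
have : good _ <<E>>%MS /\ (E <= <<E>>)%MS by split; [apply: sub Eg _|]; rewrite genmxE.
move: (<<E>>)%MS => X; have [n] := ubnP (r - \rank X); elim: n X => // n IH X rX [Xg EX].
have [XD|XD] := boolP (X *m D <= X)%MS; first by exists X.
apply: (IH (X + X *m D)%MS).
  have : (X < X + X *m D)%MS.
    by rewrite ltmxE addsmxSl /= addsmx_sub submx_refl.
  move=> /rank_ltmx; have := rank_leq_col (X + X *m D)%MS; move: rX.
  by move: (\rank (X + X *m D)%MS) (\rank X) => a b; lia.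
split; last exact: submx_trans EX (addsmxSl _ _).
apply: (sub _ _ (col_mx X (X *m D))); last by rewrite addsmxE.
(* As x X - X (x - D) = X D, the rows of X D are again combinations of the rows of the pencil. *)
have [R RA] := Xg; exists (col_mx R ('X *: R - row_mx (map_mx polyC X) 0)).
rewrite mul_col_mx map_col_mx RA; congr col_mx; rewrite mulmxBl -scalemxAl RA.
rewrite /A /stack_pencil mul_row_col mul0mx addr0 mulmxBr mul_mx_scalar opprB.
by rewrite addrC subrK map_mxM.
Qed.

(** A left inverse of the pencil of (D, E) turns it into an identity block, which then clears Y. *)
Lemma stack_pencil_reduce d r s (C : 'M[F]_d) (Y : 'M_(d, r)) (D : 'M_r) (E : 'M_(s, r)) :
  observable D E ->
  meqv (stack_pencil (block_mx C Y 0 D) (row_mx 0 E)) (block_mx (xImB C) 0 0 (1%:M : 'M_r)).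
Proof.
move=> /observable_left_inverse[R RA].
rewrite -(hsubmxK R) /stack_pencil mul_row_col in RA.
set R1 := lsubmx R in RA; set R2 := rsubmx R in RA.
set y := map_mx polyC Y; set e := map_mx polyC E in RA *; set x := 'X%:M - _ in RA.
have -> : stack_pencil (block_mx C Y 0 D) (row_mx 0 E) =
    col_mx (block_mx (xImB C) (- y) 0 x) (row_mx 0 (- e)).
  rewrite /stack_pencil xImB_sq map_block_mx map_row_mx !map_mx0 opp_row_mx oppr0.
  by rewrite scalar_mx_block opp_block_mx add_block_mx !oppr0 !addr0 !add0r.
split.
  exists (row_mx (block_mx 1%:M (y *m R1) 0 R1) (col_mx (y *m R2) R2)), 1%:M.
  rewrite mulmx1 mul_row_col mulmx_block mul_col_row !(mul1mx, mul0mx, mulmx0, addr0, add0r).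
  rewrite add_block_mx !addr0; congr block_mx; last by rewrite RA.
  by rewrite -addrA -[_ *m R1 *m _]mulmxA -[_ *m R2 *m _]mulmxA -mulmxDr RA mulmx1 addNr.
exists (col_mx (block_mx 1%:M (- y) 0 x) (row_mx 0 (- e))), 1%:M.
by rewrite mulmx1 mul_col_mx mulmx_block mul_row_block !(mul1mx, mulmx1, mul0mx, mulmx0, addr0, add0r).
Qed.

(** The rows of Q are coordinate forms: the last r cut out the largest invariant subspace, and the
    first d are coordinates on it. *)
Definition adapted d r s (Q Bt : 'M[F]_(d + r)) (Bb : 'M_(s, d + r)) : bool :=
  (Q \in unitmx) && (dsubmx Q == obs_space Bt Bb)%MS.

Lemma dsubmx_free d r (Q : 'M[F]_(d + r)) : Q \in unitmx -> row_free (dsubmx Q).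
Proof.
move=> Qu; apply/row_freeP; exists (rsubmx (invmx Q)).
by rewrite mulmx_rsub mul_dsub_mx mulmxV // scalar_mx_block /block_mx col_mxKd row_mxKr.
Qed.

(** The zero blocks say that the last rows of Q span a stable space containing the rows of [Bb];
    observability of (D, E) says that no smaller such space exists. *)
Lemma adapted_blockP d r s (Q Bt : 'M[F]_(d + r)) (Bb : 'M_(s, d + r)) : Q \in unitmx ->
  adapted Q Bt Bb <->
  exists C Y D E, [/\ Q *m Bt = block_mx C Y 0 D *m Q, Bb = row_mx 0 E *m Q & observable D E].
Proof.
move=> Qu; have Q2f := dsubmx_free Qu; rewrite /adapted Qu /=.
set Q2 := dsubmx Q in Q2f *; set K := obs_space Bt Bb.
have QE (C : 'M_d) (Y : 'M_(d, r)) (D : 'M_r) :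
    block_mx C Y 0 D *m Q = col_mx (row_mx C Y *m Q) (D *m Q2).
  by rewrite /block_mx mul_col_mx -[in X in col_mx _ X](vsubmxK Q) mul_row_col mul0mx add0r.
have RE (E : 'M_(s, r)) : row_mx 0 E *m Q = E *m Q2.
  by rewrite -[in LHS](vsubmxK Q) mul_row_col mul0mx add0r.
split=> [/eqmxP Q2K|[C [Y [D [E [QB BE obsE]]]]]].
  have /submxP[D DE] : (Q2 *m Bt <= Q2)%MS.
    by rewrite (eqmxMr Bt Q2K) Q2K obs_space_stable.
  have /submxP[E EE] : (Bb <= Q2)%MS by rewrite Q2K obs_space_sub.
  pose CY := usubmx Q *m Bt *m invmx Q.
  exists (lsubmx CY), (rsubmx CY), D, E; split.
  - rewrite QE hsubmxK mulmxKV // -DE -[in LHS](vsubmxK Q) mul_col_mx //.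
  - by rewrite RE.
  have H : (K <= obs_space D E *m Q2)%MS.
    apply: obs_space_min; first by rewrite EE submxMr // obs_space_sub.
    by rewrite -mulmxA DE mulmxA submxMr // obs_space_stable.
  have := mxrankS H; rewrite -Q2K (eqP Q2f) mxrankMfree // => rk.
  by rewrite /observable /row_full eqn_leq rank_leq_row.
have DE : Q2 *m Bt = D *m Q2.
  have := congr1 (@dsubmx _ _ _ _) QB; rewrite QE col_mxKd => <-.
  by rewrite /Q2 mul_dsub_mx.
rewrite RE in BE.
have KQ : (K <= Q2)%MS.
  by apply: obs_space_min; rewrite ?BE ?submxMl // DE submxMl.
rewrite andbC KQ /=; have /submxP[Z KE] := KQ.
have ZE : (E <= Z)%MS by rewrite -(submxMfree _ _ Q2f) -KE -BE obs_space_sub.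
have ZD : (Z *m D <= Z)%MS.
  by rewrite -(submxMfree _ _ Q2f) -mulmxA -DE mulmxA -KE obs_space_stable.
have Zf : row_full Z := row_full_le (obs_space_min ZE ZD) obsE.
by rewrite KE -{1}[Q2]mul1mx submxMr // sub1mx.
Qed.

Lemma chain_ones r (t : seq {poly F}) : chain t -> chain (nseq r 1 ++ t).
Proof.
move=> [mon dvd]; split=> [i|i j /andP[ij]]; rewrite size_cat size_nseq !nth_cat size_nseq !nth_nseq.
  by case: (ltnP i r) => ir /=; [rewrite monic1|move=> H; apply: mon; lia].
case: (ltnP i r) => ir /=; first by rewrite dvd1p.
by rewrite (ltnNge j r) (leq_trans ir ij) /= => H; apply: dvd; lia.
Qed.

Lemma stack_pencil_conj k s (Q Bt Bt' : 'M[F]_k) (Bb Bb' : 'M_(s, k)) : Q \in unitmx ->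
  Q *m Bt = Bt' *m Q -> Bb = Bb' *m Q -> meqv (stack_pencil Bt Bb) (stack_pencil Bt' Bb').
Proof.
move=> Qu QB BE; pose P := map_mx polyC Q; pose P' := map_mx polyC (invmx Q).
have PP : P *m P' = 1%:M by rewrite -map_mxM mulmxV // map_mx1.
have P'P : P' *m P = 1%:M by rewrite -map_mxM mulVmx // map_mx1.
have E : block_mx P 0 0 1%:M *m stack_pencil Bt Bb = stack_pencil Bt' Bb' *m P.
  rewrite /stack_pencil mul_block_col !mul0mx mul1mx addr0 add0r mul_col_mx mulmxBr mulmxBl.
  by rewrite -!map_mxM QB scalar_mxC mulNmx -map_mxM BE.
split; first by exists (block_mx P 0 0 1%:M), P'; rewrite E -mulmxA PP mulmx1.
exists (block_mx P' 0 0 1%:M), P; rewrite -mulmxA -E mulmxA mulmx_block.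
by rewrite !(mul0mx, mulmx0, mul1mx, addr0, add0r) P'P -scalar_mx_block mul1mx.
Qed.

Lemma invs_adapted d r s (Q Bt : 'M[F]_(d + r)) (Bb : 'M_(s, d + r)) : adapted Q Bt Bb ->
  invs (col_mx Bt Bb) = nseq r 1 ++ invs (ulsubmx (Q *m Bt *m invmx Q)).
Proof.
move=> adQ; have [Qu _] := andP adQ.
have [C [Y [D [E [QB BE obsE]]]]] := (adapted_blockP Bt Bb Qu).1 adQ.
rewrite QB mulmxK // block_mxKul.
have [[sC ch _] CE _ _] := smith_type_invs C.
apply: invs_meqv; first exact: chain_ones.
  by rewrite size_cat size_nseq sC addnC.
rewrite xImB_col; apply: meqv_trans (stack_pencil_conj Qu QB BE) _.
apply: meqv_trans (stack_pencil_reduce _ _ obsE) _.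
apply: meqv_trans (meqv_blockC _ _) _; apply: meqv_trans (meqv_diag_cat _ _).
by apply: meqv_block => //; apply: meqv_1_diag.
Qed.

Lemma ex_adapted d r s (Bt : 'M[F]_(d + r)) (Bb : 'M_(s, d + r)) :
  (\rank (obs_space Bt Bb) == r) = [exists Q : 'M_(d + r), adapted Q Bt Bb].
Proof.
set K := obs_space Bt Bb; apply/eqP/existsP => [rK|[Q /andP[Qu /eqmxP QK]]]; last first.
  by rewrite -/K -QK; apply/eqP/dsubmx_free.
have rC : \rank (K^C)%MS = d by rewrite mxrank_compl rK addnK.
have := eq_row_base K; have := eq_row_base (K^C)%MS.
move: (row_base K) (row_base (K^C)%MS); rewrite rK rC => Q2 Q1 E1 E2.
exists (col_mx Q1 Q2); rewrite /adapted col_mxKd; apply/andP; split; last exact/eqmxP.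
rewrite -row_full_unit -sub1mx -addsmxE.
by rewrite (adds_eqmx E1 E2) addsmxC sub1mx addsmx_compl_full.
Qed.

End Observability.

(** * Double counting of matrices and adapted bases *)

Section PairCount.
Variable F : finFieldType.
Implicit Types (k s d r : nat).
Local Notation q := #|F|.

Definition obs_pairs r s : {set 'M[F]_r * 'M[F]_(s, r)} := [set w | observable w.1 w.2].

Definition conj_closed d (CC : {set 'M[F]_d}) : Prop :=
  forall T C C', T \in unitmx -> T *m C = C' *m T -> C \in CC -> C' \in CC.

Section Fixed.
Variables (d r s : nat).
Local Notation k := (d + r)%N.

Lemma unitmx_ublock (T1 : 'M[F]_d) (T2 : 'M_(d, r)) (T3 : 'M_r) :
  (block_mx T1 T2 0 T3 \in unitmx) = (T1 \in unitmx) && (T3 \in unitmx).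
Proof. by rewrite !unitmxE det_ublock unitrM. Qed.

Lemma adapted_trans (Q0 Q Bt : 'M[F]_k) (Bb : 'M_(s, k)) : adapted Q0 Bt Bb ->
  adapted Q Bt Bb <->
  exists T1 T2 T3, [/\ T1 \in unitmx, T3 \in unitmx & Q = block_mx T1 T2 0 T3 *m Q0].
Proof.
case/andP=> Q0u /eqmxP E0.
have dE T1 T2 T3 : dsubmx (block_mx T1 T2 0 T3 *m Q0) = T3 *m dsubmx Q0.
  by rewrite -[in LHS](vsubmxK Q0) mul_block_col col_mxKd mul0mx add0r.
split=> [/andP[Qu /eqmxP E]|[T1 [T2 [T3 [T1u T3u ->]]]]].
  have /submxP[T3 QE] : (dsubmx Q <= dsubmx Q0)%MS by rewrite E E0.
  pose T := Q *m invmx Q0.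
  have dT : dsubmx T = row_mx 0 T3.
    rewrite -mul_dsub_mx QE -mulmxA mul_dsub_mx mulmxV // scalar_mx_block /block_mx col_mxKd.
    by rewrite mul_mx_row mulmx0 mulmx1.
  have TE : T = block_mx (lsubmx (usubmx T)) (rsubmx (usubmx T)) 0 T3.
    by rewrite /block_mx hsubmxK -dT vsubmxK.
  exists (lsubmx (usubmx T)), (rsubmx (usubmx T)), T3; rewrite -TE mulmxKV //.
  have : T \in unitmx by rewrite unitmx_mul Qu unitmx_inv.
  by rewrite {1}TE unitmx_ublock => /andP[].
rewrite /adapted unitmx_mul unitmx_ublock T1u T3u Q0u dE /=.
apply/eqmxP; apply: eqmx_trans E0; apply: eqmxMfull.
by rewrite row_full_unit.
Qed.

(** The adapted bases form a free orbit of the block upper triangular group, whose order this is. *)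
Lemma card_adapted (Q0 Bt : 'M[F]_k) (Bb : 'M_(s, k)) : adapted Q0 Bt Bb ->
  #|[set Q : 'M_k | adapted Q Bt Bb]| = (glcard F d * q ^ (d * r) * glcard F r)%N.
Proof.
move=> ad0; have [Q0u _] := andP ad0.
pose f (w : 'M[F]_d * 'M[F]_(d, r) * 'M[F]_r) := block_mx w.1.1 w.1.2 0 w.2 *m Q0.
have finj : injective f.
  move=> [[a b] c] [[a' b'] c'] /(congr1 (mulmx^~ (invmx Q0))).
  by rewrite /f !mulmxK // => /eq_block_mx[/= -> -> _ ->].
rewrite /glcard -card_mx -[#|{: 'M_(d, r)}|]cardsT -!cardsX -(card_imset _ finj).
apply: eq_card => Q; rewrite inE; apply/idP/imsetP => [/(adapted_trans _ ad0)|].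
  case=> T1 [T2 [T3 [T1u T3u ->]]]; exists (T1, T2, T3) => //.
  by rewrite !inE T1u T3u.
case=> -[[T1 T2] T3]; rewrite !inE /= => /andP[/andP[T1u _] T3u] ->.
by apply/(adapted_trans _ ad0); exists T1, T2, T3.
Qed.

Definition restr_class (CC : {set 'M[F]_d}) : {set 'M[F]_k * 'M[F]_(s, k)} :=
  [set w | [exists Q, adapted Q w.1 w.2 && (ulsubmx (Q *m w.1 *m invmx Q) \in CC)]].

(** A change of adapted basis conjugates the restriction by the diagonal block [T1], which a
    conjugation-closed class does not notice. *)
Lemma restr_classP CC (Q Bt : 'M[F]_k) (Bb : 'M_(s, k)) : conj_closed CC -> adapted Q Bt Bb ->
  ((Bt, Bb) \in restr_class CC) = (ulsubmx (Q *m Bt *m invmx Q) \in CC).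
Proof.
move=> cc adQ; rewrite inE /=; apply/existsP/idP => [[Q0 /andP[ad0 H0]]|H]; last first.
  by exists Q; rewrite adQ.
have [T1 [T2 [T3 [T1u T3u QE]]]] := (adapted_trans Q ad0).1 adQ.
have [Q0u _] := andP ad0; have [Qu _] := andP adQ.
have [C [Y [D [E [QB _ _]]]]] := (adapted_blockP Bt Bb Q0u).1 ad0.
have [C' [Y' [D' [E' [QB' _ _]]]]] := (adapted_blockP Bt Bb Qu).1 adQ.
rewrite QB' mulmxK // block_mxKul; move: H0; rewrite QB mulmxK // block_mxKul.
apply: (cc T1) => //.
have : block_mx T1 T2 0 T3 *m block_mx C Y 0 D = block_mx C' Y' 0 D' *m block_mx T1 T2 0 T3.
  apply: (can_inj (mulmxK Q0u)); rewrite -!mulmxA -QE -QB' -QB [in RHS]QE.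
  by rewrite !mulmxA.
by rewrite !mulmx_block !mulmx0 !addr0 => /eq_block_mx[].
Qed.

(** Pairs (Q, B) with Q adapted to B: for given Q the blocks C, Y and (D, E) are free, for given B
    the number of Q is constant. All of M_d as [CC] yields [rank_count], a type class the final
    formula. *)
Lemma pair_count CC : conj_closed CC ->
  (glcard F k * (#|CC| * q ^ (d * r) * #|obs_pairs r s|) =
   #|restr_class CC| * (glcard F d * q ^ (d * r) * glcard F r))%N.
Proof.
move=> cc.
pose f (z : 'M[F]_k * ('M[F]_d * 'M[F]_(d, r) * ('M[F]_r * 'M[F]_(s, r)))) :=
  (z.1, (invmx z.1 *m block_mx z.2.1.1 z.2.1.2 0 z.2.2.1 *m z.1, row_mx 0 z.2.2.2 *m z.1)).
pose Z := [set z : 'M[F]_k * ('M[F]_k * 'M[F]_(s, k)) |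
  adapted z.1 z.2.1 z.2.2 && (ulsubmx (z.1 *m z.2.1 *m invmx z.1) \in CC)].
transitivity #|Z|.
  rewrite /glcard -card_mx -[#|{: 'M_(d, r)}|]cardsT -!cardsX -(card_in_imset (f := f)).
    apply: eq_card => -[Q [Bt Bb]]; apply/imsetP/idP => [[[Q' [[C Y] [D E]]]]|].
      rewrite !inE /= => /and3P[Qu /andP[CCC _] obsE] [-> -> ->] /=.
      have QB : Q' *m (invmx Q' *m block_mx C Y 0 D *m Q') = block_mx C Y 0 D *m Q'.
        by rewrite !mulmxA mulmxV // mul1mx.
      rewrite QB mulmxK // block_mxKul CCC andbT.
      by apply/(adapted_blockP _ _ Qu); exists C, Y, D, E.
    rewrite !inE /= => /andP[ad H]; have [Qu _] := andP ad.
    have [C [Y [D [E [QB BE obsE]]]]] := (adapted_blockP Bt Bb Qu).1 ad.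
    exists (Q, (C, Y, (D, E))).
      by move: H; rewrite QB mulmxK // block_mxKul !inE /= Qu obsE => ->.
    by rewrite /f /= -mulmxA -QB mulKmx // -BE.
  move=> [Q [[C Y] [D E]]] [Q' [[C' Y'] [D' E']]]; rewrite !inE /= => /andP[Qu _] _ [<- E1 E2].
  move: E1 => /(congr1 (fun A => Q *m A *m invmx Q)).
  rewrite !mulmxA mulmxV // !mul1mx !mulmxK // => /eq_block_mx[-> -> _ ->].
  move: E2 => /(congr1 (mulmx^~ (invmx Q))).
  by rewrite !mulmxK // => /eq_row_mx[_ ->].
rewrite -sum1_card -sum_nat_const.
transitivity (\sum_(w in restr_class CC) \sum_(Q : 'M[F]_k | adapted Q w.1 w.2) 1)%N.
  rewrite pair_big_dep /= (reindex (fun z : ('M[F]_k * 'M[F]_(s, k)) * 'M[F]_k => (z.2, z.1))) /=.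
    apply: eq_bigl => -[[Bt Bb] Q]; rewrite inE /= andbC.
    by case: (boolP (adapted Q Bt Bb)) => [ad|_]; rewrite ?andbF ?andbT // (restr_classP cc ad).
  by exists (fun z => (z.2, z.1)) => -[].
apply: eq_bigr => -[Bt Bb]; rewrite inE /= => /existsP[Q /andP[ad _]].
by rewrite -(card_adapted ad) -sum1_card; apply: eq_bigl => Q'; rewrite inE.
Qed.

End Fixed.

Lemma type_class_closed d t : conj_closed (type_class d t : {set 'M[F]_d}).
Proof.
by move=> T C C' Tu TC; rewrite !inE (invs_conj Tu TC).
Qed.

Lemma rank_count k s d r : k = (d + r)%N ->
  (glcard F k * (q ^ (d * d) * #|obs_pairs r s|) =
   #|[set w : 'M[F]_k * 'M[F]_(s, k) | \rank (obs_space w.1 w.2) == r]| *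
   (glcard F d * glcard F r))%N.
Proof.
move=> ->; have cc : conj_closed [set: 'M[F]_d] by move=> *; rewrite inE.
have := pair_count r s cc; rewrite cardsT card_mx.
have -> : restr_class r s [set: 'M[F]_d] = [set w | \rank (obs_space w.1 w.2) == r].
  apply/setP=> -[Bt Bb]; rewrite !inE /= ex_adapted.
  by apply: eq_existsb => Q; rewrite inE andbT.
have q0 : (0 < q ^ (d * r))%N by rewrite expn_gt0 card_field_gt0.
rewrite /obs_pairs; move: #|_| #|_| (glcard _ _) (glcard _ _) (glcard _ _) => R N a b c E.
apply/eqP; rewrite -(eqn_pmul2l q0); apply/eqP; move: E; move: (q ^ _)%N (q ^ _)%N => x y E.
by transitivity (c * (x * y * N))%N; [ring|rewrite E; ring].
Qed.

(** Ones have degree 0 and the square block contributes its size. Hence prescribing the invariant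
    factors fixes the dimension of the largest invariant subspace. *)
Lemma degsum_rank k s (Bt : 'M[F]_k) (Bb : 'M_(s, k)) :
  (degsum (invs (col_mx Bt Bb)) + \rank (obs_space Bt Bb))%N = k.
Proof.
set r := \rank _; have [d kE] : exists d, k = (d + r)%N.
  by exists (k - r)%N; rewrite subnK // rank_leq_row.
move: (erefl r); rewrite {1}/r; move: r kE => r kE; subst k.
move=> /eqP; rewrite ex_adapted => /existsP[Q /invs_adapted ->].
rewrite degsum_cat degsum_nseq1 add0n.
by have [[_ _ ->] _ _ _] := smith_type_invs (ulsubmx (Q *m Bt *m invmx Q)).
Qed.

Lemma card_invs d r s t : size t = d -> degsum t = d ->
  #|[set B : 'M[F]_(d + r + s, d + r) | invs B == nseq r 1 ++ t]| =
  #|restr_class r s (type_class d t)|.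
Proof.
move=> st dt; pose f (w : 'M[F]_(d + r) * 'M[F]_(s, d + r)) := col_mx w.1 w.2.
have finj : injective f by move=> [a b] [a' b'] /eq_col_mx[/= -> ->].
rewrite -(card_imset _ finj); apply: eq_card => B; rewrite inE.
apply/eqP/imsetP => [BE|[[Bt Bb]]].
  exists (usubmx B, dsubmx B); last by rewrite /f vsubmxK.
  have := degsum_rank (usubmx B) (dsubmx B).
  rewrite vsubmxK BE degsum_cat degsum_nseq1 dt => /addnI/eqP.
  rewrite ex_adapted => /existsP[Q ad].
  rewrite (restr_classP (type_class_closed (t := t)) ad) inE.
  have := invs_adapted ad; rewrite vsubmxK BE => /(congr1 (drop r)).
  by rewrite !drop_size_cat ?size_nseq // => <-.
rewrite inE => /existsP[Q /andP[ad]]; rewrite inE => /eqP tE ->.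
by rewrite /f /= (invs_adapted ad) tE.
Qed.

End PairCount.

(** * Final count *)

Section QIdentities.
Implicit Types (q n k d r : nat).

(** The q-factorial without its denominators q - 1. *)
Definition qfact q n : rat := \prod_(i < n) ((q ^ i.+1)%:R - 1).

Lemma qfactS q n : qfact q n.+1 = qfact q n * ((q ^ n.+1)%:R - 1).
Proof. by rewrite /qfact big_ord_recr. Qed.

Lemma qfact_neq0 q n : (1 < q)%N -> qfact q n != 0.
Proof.
move=> q1; apply/prodf_neq0 => i _; rewrite subr_eq0 pnatr_eq1.
by rewrite gtn_eqF // -(expn0 q) ltn_exp2l.
Qed.

Lemma qbinomE q d r : (1 < q)%N -> qbinom q (d + r) d = qfact q (d + r) / (qfact q d * qfact q r).
Proof.
move=> q1; have f0 n := qfact_neq0 n q1.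
have -> : qbinom q (d + r) d = (\prod_(i < d) ((q ^ (d + r - i))%:R - 1)) / qfact q d.
  by rewrite /qbinom big_split /= prodfV.
suff -> : qfact q (d + r) = (\prod_(i < d) ((q ^ (d + r - i))%:R - 1)) * qfact q r.
  by field; rewrite !f0.
elim: d => [|d IH]; first by rewrite big_ord0 mul1r.
rewrite addSn qfactS IH big_ord_recl subn0 /=;
ring.
Qed.

Lemma qbinom0 q k : qbinom q k 0 = 1.
Proof. by rewrite /qbinom big_ord0. Qed.

Lemma qbinom_big q k : qbinom q k k.+1 = 0.
Proof. by rewrite /qbinom big_ord_recr /= subnn expn0 subrr mul0r mulr0. Qed.

Lemma qbinomn q k : (1 < q)%N -> qbinom q k k = 1.
Proof.
move=> q1; have := qbinomE k 0 q1.
by rewrite addn0 [qfact q 0]/qfact big_ord0 mulr1 divff ?qfact_neq0.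
Qed.

Lemma qbinom_pascal q k d : (1 < q)%N -> (d <= k)%N ->
  qbinom q k.+1 d.+1 = qbinom q k d.+1 + (q ^ (k - d))%:R * qbinom q k d.
Proof.
move=> q1 /subnKC <-; rewrite addKn; move: (k - d)%N => r.
have f0 n := qfact_neq0 n q1.
have f1 n : (q ^ n.+1)%:R - 1 != 0 :> rat by have := f0 n.+1; rewrite qfactS mulf_eq0 negb_or => /andP[].
case: r => [|r]; first by rewrite addn0 qbinom_big add0r expn0 mul1r !qbinomn.
have := qbinomE d.+1 r.+1 q1; rewrite addSn => ->.
have := qbinomE d.+1 r q1; rewrite addSnnS => ->.
rewrite qbinomE // (qfactS q (d + r.+1)) (qfactS q d) (qfactS q r).
have -> : ((d + r.+1).+1 = d.+1 + r.+1)%N by rewrite addSn.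
rewrite expnD natrM.
by field; rewrite ?f0 ?f1.
Qed.

(** The q-Pascal rule splits the sum for k + 1 into (X - q^(k+1)) X^k and q^(k+1) X^k. The second
    part uses the induction hypothesis at X / q, so X has to vary. *)
Lemma q_chu_vandermonde q k (X : rat) : (1 < q)%N ->
  \sum_(d < k.+1) qbinom q k d * (q ^ (d * d))%:R * \prod_(d.+1 <= i < k.+1) (X - (q ^ i)%:R)
  = X ^+ k.
Proof.
move=> q1; have q0 : q%:R != 0 :> rat by rewrite pnatr_eq0 -lt0n ltnW.
elim: k X => [|k IH] X.
  by rewrite big_ord_recl big_ord0 qbinom0 big_geq // muln0 expn0 !mulr1 addr0.
pose P d n := \prod_(d.+1 <= i < n.+1) (X - (q ^ i)%:R).
rewrite big_ord_recl qbinom0.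
under [X in _ + X]eq_bigr => d _ do rewrite lift0 (qbinom_pascal q1 (leq_ord d)) mulrDl mulrDl.
rewrite big_split /= addrA.
have -> : (1 * (q ^ (0 * 0))%:R * P 0%N k.+1) +
    \sum_(d < k.+1) qbinom q k d.+1 * (q ^ (d.+1 * d.+1))%:R * P d.+1 k.+1 =
    (X - (q ^ k.+1)%:R) * X ^+ k.
  transitivity (\sum_(d < k.+2) qbinom q k d * (q ^ (d * d))%:R * P d k.+1).
    by rewrite [RHS]big_ord_recl qbinom0; congr (_ + _); apply: eq_bigr => d _; rewrite lift0.
  rewrite big_ord_recr /= qbinom_big !mul0r addr0 -IH big_distrr /=.
  apply: eq_bigr => d _; rewrite /P big_nat_recr /=; last by rewrite ltnS -ltnS.
  ring.
have -> : \sum_(d < k.+1) (q ^ (k - d))%:R * qbinom q k d * (q ^ (d.+1 * d.+1))%:R * P d.+1 k.+1 =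
    (q ^ k.+1)%:R * X ^+ k.
  have -> : (q ^ k.+1)%:R * X ^+ k = (q ^ (2 * k + 1))%:R * (X / q%:R) ^+ k.
    rewrite expr_div_n !natrX; have -> : (2 * k + 1 = k.+1 + k)%N by lia.
    by rewrite exprD; field; rewrite expf_neq0.
  rewrite -IH big_distrr /=; apply: eq_bigr => d _.
  have dk : (d <= k)%N by rewrite -ltnS.
  (* Each of the k - d factors gives up one q, which lowers its index by one and replaces X by X /
     q. *)
  have -> : P d.+1 k.+1 = (q ^ (k - d))%:R * \prod_(d.+1 <= i < k.+1) (X / q%:R - (q ^ i)%:R).
    rewrite /P big_add1 /= natrX -[(k - d)%N]subSS -prodr_const_nat -big_split /=.
    by apply: eq_bigr => i _; rewrite expnS natrM; field.
  have E : (q ^ (2 * k + 1))%:R * (q ^ (d * d))%:R =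
      (q ^ (k - d))%:R * (q ^ (d.+1 * d.+1))%:R * (q ^ (k - d))%:R :> rat.
    by rewrite -!natrM -!expnD; congr (_ ^ _)%:R; lia.
  by rewrite [RHS]mulrA [_ * (qbinom _ _ _ * _)]mulrCA E; ring.
rewrite exprS; ring.
Qed.

End QIdentities.

(** * Orders of linear groups, observable pairs and the final formula *)

Section Final.
Variable F : finFieldType.
Local Notation q := #|F|.

Lemma card_field_gt1 : (1 < q)%N.
Proof. exact: finNzRing_gt1. Qed.

Lemma glcardE n : (glcard F n)%:R = (q ^ 'C(n, 2))%:R * qfact q n :> rat.
Proof.
case: n => [|n]; first by rewrite glcard0 /qfact big_ord0 mulr1.
have -> : glcard F n.+1 = #|('GL_n.+1[F])%g|.
  rewrite cardsT card_sub; apply: eq_card => A; rewrite inE //.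
rewrite card_GL // natrM; congr (_ * _); rewrite natr_prod big_add1 /= big_mkord.
by apply: eq_bigr => i _; rewrite natrB // expn_gt0 card_field_gt0.
Qed.

(** The index of the block triangular group is the number of d-dimensional subspaces. *)
Lemma glcard_quot d r : (glcard F (d + r))%:R =
  qbinom q (d + r) d * (q ^ (d * r))%:R * (glcard F d)%:R * (glcard F r)%:R :> rat.
Proof.
have q1 := card_field_gt1.
rewrite !glcardE qbinomE //; have -> : 'C(d + r, 2) = ('C(d, 2) + 'C(r, 2) + d * r)%N.
  elim: r => [|r IH]; first by rewrite bin0n /= muln0 !addn0.
  rewrite addnS !binS !bin1 IH; lia.
by rewrite !expnD !natrM; field; rewrite !qfact_neq0.
Qed.

Lemma prod_shift d r s : (q ^ (d * r))%:R * \prod_(1 <= i < r.+1) ((q ^ (r + s))%:R - (q ^ i)%:R)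
  = \prod_(d.+1 <= i < (d + r).+1) ((q ^ (d + r + s))%:R - (q ^ i)%:R) :> rat.
Proof.
rewrite -[d.+1]add1n big_addn -addnS addKn.
have -> : (q ^ (d * r))%:R = \prod_(1 <= i < r.+1) (q ^ d)%:R :> rat.
  by rewrite prodr_const_nat subn1 expnM natrX.
rewrite -big_split /=; apply: eq_bigr => i _.
by rewrite mulrBr -!natrM -!expnD addnA [(i + d)%N]addnC.
Qed.

(** All q^((k+s)k) matrices are sorted by the rank of [obs_space]. Every class except that of full
    rank is known from smaller sizes and equals its term in [q_chu_vandermonde] at X = q^(k+s), so
    the remaining terms agree as well. *)
Lemma card_obs_pairs r s : #|obs_pairs F r s|%:R =
  \prod_(1 <= i < r.+1) ((q ^ (r + s))%:R - (q ^ i)%:R) :> rat.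
Proof.
have q1 := card_field_gt1.
have [n] := ubnP r; elim: n r => // n IH k kn.
pose N r : nat := #|[set w : 'M[F]_k * 'M[F]_(s, k) | \rank (obs_space w.1 w.2) == r]|.
have NE d r : k = (d + r)%N ->
    (N r)%:R = qbinom q k d * (q ^ (d * d))%:R * ((q ^ (d * r))%:R * #|obs_pairs F r s|%:R) :> rat.
  move=> kE; have := congr1 (fun x : nat => x%:R : rat) (rank_count F s kE).
  rewrite /= !natrM {1}kE glcard_quot -kE => E.
  have g0 := glcard_neq0 F d; have g1 := glcard_neq0 F r.
  by apply: (mulIf g0); apply: (mulIf g1); rewrite -mulrA -E; ring.
have tot : \sum_(d < k.+1) (N (k - d)%N)%:R = (q ^ (k + s))%:R ^+ k :> rat.
  rewrite -natr_sum -natrX -expnM mulnC mulnDr [(k * s)%N]mulnC expnD -!card_mx.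
  rewrite -card_prod -sum1_card; congr _%:R.
  (* Reversing the index sorts by d = k - rank, the summation variable of the identity. *)
  rewrite (partition_big (fun w : 'M[F]_k * 'M[F]_(s, k) => rev_ord (inord (\rank (obs_space w.1 w.2)) : 'I_k.+1)) predT) //=.
  apply: eq_bigr => d _; rewrite /N -sum1_card; apply: eq_bigl => w; rewrite inE.
  rewrite -(inj_eq rev_ord_inj) rev_ordK -(inj_eq val_inj) /= inordK ?ltnS ?rank_leq_row //.
rewrite -(q_chu_vandermonde k _ q1) !big_ord_recl in tot.
have N0 : (N k)%:R = #|obs_pairs F k s|%:R :> rat.
  by rewrite (NE 0%N k) // qbinom0 !mul0n expn0 !mul1r.
have tail (d : 'I_k) : true -> (N (k - lift ord0 d)%N)%:R =
    qbinom q k (lift ord0 d) * (q ^ (lift ord0 d * lift ord0 d))%:R *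
    \prod_((lift ord0 d).+1 <= i < k.+1) ((q ^ (k + s))%:R - (q ^ i)%:R) :> rat.
  move=> _; rewrite lift0.
  have kE : k = (d.+1 + (k - d.+1))%N by rewrite subnKC.
  rewrite (NE _ _ kE) IH; last by move: kn (ltn_ord d); lia.
  by rewrite prod_shift -kE.
move: tot; rewrite (eq_bigr _ tail) => /addIr.
by rewrite subn0 N0 qbinom0 mul0n expn0 !mul1r.
Qed.

End Final.

Theorem theorem3 (F : finFieldType) (n k d : nat) (p : seq {poly F})
    (S : seq {poly F}) :
  is_invf_tuple k p ->
  (size (\prod_(pi <- p) pi)).-1 = d ->
  (d <= k)%N -> (k <= n)%N ->
  uniq S ->
  (forall f : {poly F},
      f \in S <-> [/\ f \is monic, irreducible_poly f & f %| \prod_(pi <- p) pi]) ->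
  (#|[set B : 'M[F]_(n, k) | has_invf B p]|)%:R =
    qbinom #|F| k d * (glcard F d)%:R
      / (\prod_(f <- S) cf #|F| (size f).-1 (Phi p f))
      * \prod_(d.+1 <= i < k.+1) (((#|F| ^ n)%:R : rat) - (#|F| ^ i)%:R).
Proof.
move=> [sp pmon pdvd] dE dk kn Su SP.
have ch : chain p.
  split=> [i|i j /andP[ij]]; rewrite sp; first exact: pmon.
  elim: j ij => [|j IH]; first by rewrite leqn0 => /eqP ->.
  rewrite leq_eqVlt => /predU1P[-> //|]; rewrite ltnS => ij js.
  by apply: dvdp_trans (IH ij (ltnW js)) _; apply: pdvd.
have mon := chain_monic ch.
have ds : degsum p = d.
  rewrite -dE /degsum; elim: (p) mon => [|a s IH] mon; first by rewrite !big_nil size_poly1.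
  rewrite !big_cons size_mul_pred ?IH //.
  - by move=> t ts; apply: mon; rewrite inE ts orbT.
  - by apply/monic_neq0/mon; rewrite mem_head.
  by rewrite prodf_seq_neq0; apply/allP => t ts; apply/monic_neq0/mon; rewrite inE ts orbT.
have [r kE] : exists r, k = (d + r)%N by exists (k - d)%N; rewrite subnKC.
have [s nE] : exists s, n = (d + r + s)%N by exists (n - k)%N; rewrite -kE subnKC.
(* Total degree d on d + r entries leaves at least r leading ones; the other d entries are the type
   of the square block. *)
rewrite nE; rewrite kE in sp *; have [|t pE] := ones_prefix (j := r) ch; first by rewrite ds sp.
have st : size t = d by move: sp; rewrite pE size_cat size_nseq; lia.
have dt : degsum t = d by move: ds; rewrite pE degsum_cat degsum_nseq1.
have cht : chain t by move: ch; rewrite pE => /chain_catr.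
have cov : covers S p.
  split=> // [f /SP[]//|f u up fm fi fu]; apply/SP; split=> //.
  by apply: dvdp_trans fu _; rewrite (big_rem u) //= dvdp_mulIl.
have covt : covers S t by apply: covers_sub cov => u ut; rewrite pE mem_cat ut orbT.
(* Ones have valuation 0 at every prime and leave no trace in the partitions. *)
have WE : \prod_(f <- S) cf #|F| (size f).-1 (Phi p f) = class_weight t S.
  apply: eq_big_seq => f /SP[_ fi _]; congr cf; rewrite !PhiE // pE map_cat filter_cat map_nseq nu1 //.
  by rewrite filter_nseq.
have -> : [set B : 'M[F]_(d + r + s, d + r) | has_invf B p] =
    [set B | invs B == nseq r 1 ++ t].
  by apply/setP=> B; rewrite !inE has_invfE // -pE.
rewrite card_invs // WE -prod_shift -card_obs_pairs.
have C := class_card st cht dt covt.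
have := congr1 (fun x : nat => x%:R : rat) (pair_count r s (type_class_closed (t := t) (d := d))).
rewrite /= !natrM glcard_quot => E.
have g0 := glcard_neq0 F d; have g1 := glcard_neq0 F r.
have W0 : class_weight t S != 0 by apply: contraNneq g0 => W0; rewrite -C W0 mulr0.
have qr0 : (#|F| ^ (d * r))%:R != 0 :> rat := qn_neq0 F _.
apply: (mulIf g0); apply: (mulIf g1); apply: (mulIf qr0).
transitivity (#|restr_class r s (type_class d t)|%:R *
  ((glcard F d)%:R * (#|F| ^ (d * r))%:R * (glcard F r)%:R) : rat); first by ring.
by rewrite -E -{2}C; field.
Qed.
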